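(* Divide $I^d=[-1,1]^d$ into generic Voronoi cells whose centers are selected by a uniform Poisson process, and color each cell black with probability $1/d$ (independently for different cells). Then for any given pair of opposite faces of $I^d$, the probability that the two faces are connected by a chain of black cells is $\ge 1/d$.
   Context: The Poisson process on $I^d$ has uniform (constant) intensity, and is considered on the event that there is at least one center; the Voronoi cell of a center is the set of points of $I^d$ at least as close to it as to any other center. A chain of black cells connecting two opposite $(d-1)$-dimensional faces of $I^d$ is a finite sequence of black cells, consecutive ones sharing a common $(d-1)$-dimensional face, with the first cell meeting one of the two faces of $I^d$ and the last cell meeting the other. *)

(* Defs.v *)
From HB Require Import structures.
From mathcomp Require Import all_boot all_order all_algebra.
From mathcomp Require Import all_classical all_reals all_analysis.

Set Implicit Arguments.
Unset Strict Implicit.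
Unset Printing Implicit Defensive.

Import Order.TTheory GRing.Theory Num.Theory.
Import numFieldNormedType.Exports.

Local Open Scope classical_set_scope.
Local Open Scope ring_scope.

(* The space R^d is d.-tuple R, which carries the product sigma-algebra of
   the Borel sigma-algebra of R. *)

Definition edist (R : realType) (d : nat) (x y : d.-tuple R) : R :=
  Num.sqrt (\sum_(k < d) (tnth x k - tnth y k) ^+ 2).

(* I^d = [-1, 1]^d *)
Definition cube (R : realType) (d : nat) : set (d.-tuple R) :=
  [set x | forall k : 'I_d, -1 <= tnth x k <= 1].

(* cube_face k false is the facet x_k = 1 and cube_face k true is the
   opposite one, x_k = -1. *)
Definition cube_face (R : realType) (d : nat) (k : 'I_d) (s : bool) :
    set (d.-tuple R) :=
  [set x | cube x /\ tnth x k = (-1) ^+ s].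

Definition voronoi_cell (R : realType) (d : nat) (S : set (d.-tuple R))
    (p : d.-tuple R) : set (d.-tuple R) :=
  [set x | cube x /\ forall q, S q -> edist x p <= edist x q].

(* F is the face of the polytope C cut out by an inequality <c, x> <= c0 that
   is valid on C. *)
Definition is_face (R : realType) (d : nat) (F C : set (d.-tuple R)) : Prop :=
  exists (c : d.-tuple R) (c0 : R),
    (forall x, C x -> \sum_(k < d) tnth c k * tnth x k <= c0) /\
    F = C `&` [set x | \sum_(k < d) tnth c k * tnth x k = c0].

Definition affinely_independent (R : realType) (d m : nat)
    (p : 'I_m.+1 -> d.-tuple R) : bool :=
  row_free (\matrix_(i < m, k < d)
    (tnth (p (lift ord0 i)) k - tnth (p ord0) k)).

Definition has_dimension (R : realType) (d : nat) (A : set (d.-tuple R))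
    (m : nat) : Prop :=
  (exists p : 'I_m.+1 -> d.-tuple R,
    (forall i, A (p i)) /\ affinely_independent p) /\
  (forall p : 'I_m.+2 -> d.-tuple R,
    (forall i, A (p i)) -> ~~ affinely_independent p).

Definition share_facet (R : realType) (d : nat) (C D : set (d.-tuple R)) :
    Prop :=
  exists F, [/\ is_face F C, is_face F D & has_dimension F d.-1].

(* The centers x 0, ..., x (n - 1) have a chain of black cells
   i :: c connecting the two faces of the cube orthogonal to the k-th axis. *)
Definition black_chain_connects (R : realType) (d n : nat)
    (x : nat -> d.-tuple R) (black : nat -> bool) (k : 'I_d) : Prop :=
  let cell i := voronoi_cell [set x j | j in `I_n] (x i) in
  exists (i : nat) (c : seq nat) (s : bool),
    [/\ all (fun j => (j < n)%N && black j) (i :: c),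
        path (fun j l => `[< share_facet (cell j) (cell l) >]) i c,
        cell i `&` cube_face k s !=set0 &
        cell (last i c) `&` cube_face k (~~ s) !=set0].

(* Lebesgue measure on R^n, as an iterated integral. *)
Fixpoint volume (R : realType) (n : nat) : set (n.-tuple R) -> \bar R :=
  match n with
  | 0 => fun A => \d_([tuple] : 0.-tuple R) A
  | n'.+1 => fun A =>
      (\int[lebesgue_measure]_x volume [set t : n'.-tuple R | A [tuple of x :: t]])%E
  end.

Section process.
Context (R : realType) (disp : measure_display) (T : measurableType disp).
Context (P : probability T R) (d : nat).
Context (N : T -> nat) (X : nat -> T -> d.-tuple R).

(* A point process is a random finite set { X i w | i < N w }, listed without
   repetition; center_count A is the number of its points in A. *)
Definition center_count (A : set (d.-tuple R)) (w : T) : nat :=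
  #|[set i : 'I_(N w) | X i w \in A]|.

(* The Poisson process of constant intensity lambda on the cube. The second
   argument of poisson_prob is a dummy: poisson_prob r _ is the Poisson law of
   mean r (the Dirac mass at 0 when r = 0). *)
Definition poisson_process_on_cube (lambda : R) : Prop :=
  [/\ forall w i j, (i < N w)%N -> (j < N w)%N -> X i w = X j w -> i = j,
      forall w i, (i < N w)%N -> cube (X i w),
      forall A : set (d.-tuple R), measurable A -> A `<=` @cube R d ->
        forall U : set nat,
        P (center_count A @^-1` U) = poisson_prob (lambda * fine (volume A)) 0%N U
    & forall (m : nat) (A : 'I_m -> set (d.-tuple R)) (n : 'I_m -> nat),
        (forall i, measurable (A i)) -> (forall i, A i `<=` @cube R d) ->
        (forall i j, i != j -> A i `&` A j = set0) ->
        P [set w | forall i, center_count (A i) w = n i] =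
        (\prod_(i < m) P [set w | center_count (A i) w = n i])%E].

(* The sigma-algebra generated by N and all the X i. *)
Definition centers_sigma_algebra : set (set T) :=
  <<s [set B | (exists U : set nat, B = N @^-1` U) \/
               (exists (i : nat) (A : set (d.-tuple R)),
                 measurable A /\ B = X i @^-1` A)] >>.

(* Given the centers, their colors are i.i.d., each being black (true) with
   probability p. *)
Definition iid_coloring (p : R) (black : nat -> T -> bool) : Prop :=
  forall (n : nat) (G : set T) (beta : nat -> bool), centers_sigma_algebra G ->
    P ([set w | N w = n] `&` G `&`
       [set w | forall i, (i < n)%N -> black i w = beta i]) =
    (P ([set w | N w = n] `&` G) *
     \prod_(i < n) (bernoulli_pmf p (beta i))%:E)%E.

Definition cond_prob (A B : set T) : R := fine (P (A `&` B)) / fine (P B).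

End process.

(* Main.v *)
Require Import Defs.
From HB Require Import structures.
From mathcomp Require Import all_boot all_order all_algebra.
From mathcomp Require Import all_classical all_reals all_analysis.
From mathcomp Require Import fingroup perm measurable_realfun ring lra.

(** Color the cells with d colors, uniformly and independently. By the d-dimensional
    Hex theorem, for some k a chain of cells of color k connects the k-th pair of faces.
    Each color class is a black set of parameter 1/d, and by the invariance of the
    process under permutations of the coordinates all pairs of faces are equally likely
    to be connected; hence each probability is at least 1/d.

    Hex follows from the Poincaré-Miranda theorem, itself the limit of Kuhn's cubical
    lemma, which is a mod 2 Stokes argument for the cubical cup product of d coboundaries.
    It gives chains of cells that merely intersect. Two cells which intersect without
    sharing a facet determine, for fixed other centers, at most one position of the first
    center on each ray issued from the second one, and a set with this property has
    volume 0.

    The law of the centers is determined by the counts: on configurations of n distinct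
    points, the law symmetrized over all relabelings is a multiple of the product
    measure, because both agree on products of disjoint sets. *)

Import Order.TTheory GRing.Theory Num.Theory.
Import numFieldNormedType.Exports.

Set Implicit Arguments.
Unset Strict Implicit.
Unset Printing Implicit Defensive.

Local Open Scope ring_scope.

(** * Kuhn's cubical lemma *)

(** The coloring with d colors is never realized on the probability space. For fixed n and a fixed
    configuration, Hex is applied to each of the d^n colorings; averaging over them and grouping by
    color class turns the weights d^-n into Bernoulli weights of parameter 1/d, for every k at once.
    The bounds are then summed over the slices N = n with n > 0.

    A common facet is a face of dimension d - 1 of two polytopes, a notion awkward to measure or to
    perturb. It is replaced by a point in the relative interior of the facet: one equation and
    finitely many strict inequalities. Strict inequalities survive small displacements and can be
    tested at rational points, which serves both the geometry and the measurability of the chain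
    event.

    The listing of the centers is arbitrary, so their joint law as a tuple is unknown and need not
    be invariant under permutations of the coordinates. Since the colors are exchangeable given the
    centers, chain probabilities averaged over the colors only depend on the symmetrized law, which
    is invariant. *)

Section CupProduct.
Variable d : nat.
Local Notation vertex := {ffun 'I_d -> nat}.
Local Notation K := 'F_2.

Lemma F2_addrr (x : K) : x + x = 0.
Proof. exact: (addrr_pchar2 (pchar_Fp (isT : prime 2))). Qed.

Lemma F2_subr (x y : K) : x - y = x + y.
Proof. by rewrite (oppr_pchar2 (pchar_Fp (isT : prime 2))). Qed.

Definition bumpv (k : 'I_d) (v : vertex) : vertex := [ffun i => (v i + (i == k))%N].

Lemma bumpvC k l v : bumpv k (bumpv l v) = bumpv l (bumpv k v).
Proof. by apply/ffunP => i; rewrite !ffunE addnAC. Qed.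

(* The cup product of the coboundaries of [fs] on the cube with corner [v] and edge
   directions [D], expanded as a sum over the monotone edge paths starting at [v]. *)
Fixpoint cup (fs : seq (vertex -> K)) (v : vertex) (D : {set 'I_d}) : K :=
  if fs is f :: fs' then
    \sum_(k in D) (f (bumpv k v) - f v) * cup fs' (bumpv k v) (D :\ k)
  else 1.

(** The terms of [(k, l)] and [(l, k)] are equal and cancel in characteristic 2; this plays the part
    of the signs in an oriented boundary. *)
Lemma sum_symmetric0 (D : {set 'I_d}) (F : 'I_d -> 'I_d -> K) :
  (forall k l, F k l = F l k) -> \sum_(k in D) \sum_(l in D :\ k) F k l = 0.
Proof.
move=> Fsym; rewrite pair_big_dep /=.
rewrite (bigID (fun p : 'I_d * 'I_d => (p.1 < p.2)%N)) /=.
rewrite [X in _ + X](reindex_inj (h := fun p : 'I_d * 'I_d => (p.2, p.1))) /=; last first.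
  by move=> [a b] [a' b'] [-> ->].
rewrite [X in _ + X](_ : _ = \sum_(i | [&& i.1 \in D, i.2 \in D :\ i.1 & (i.1 < i.2)%N])
  F i.1 i.2); last first.
  apply: eq_big => [[a b]|[a b] _] /=; last exact: Fsym.
  rewrite !inE; case: (ltngtP a b) => [ab|ab|/val_inj->]; rewrite ?eqxx ?andbF //=.
  by rewrite !andbT eq_sym -(inj_eq val_inj) /= (gtn_eqF ab) /= andbC.
under eq_bigl do rewrite -andbA.
exact: F2_addrr.
Qed.

Lemma sum_pair_exchange (D : {set 'I_d}) (F : 'I_d -> 'I_d -> K) :
  \sum_(k in D) \sum_(l in D :\ k) F k l = \sum_(k in D) \sum_(l in D :\ k) F l k.
Proof.
rewrite (exchange_big_dep (mem D)) /=; last by move=> i j _; rewrite !inE => /andP[].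
apply: eq_bigr => k kD; apply: eq_bigl => l.
by rewrite !inE kD andbT eq_sym andbC.
Qed.

Lemma setD1C (D : {set 'I_d}) k l : D :\ k :\ l = D :\ l :\ k.
Proof. by apply/setP => i; rewrite !inE andbCA. Qed.

(* The coboundary of the product cochain vanishes: mod 2, the faces opposite to
   the corner [v] contribute as much as the faces through [v]. *)
Lemma cup_closed (fs : seq (vertex -> K)) (v : vertex) (D : {set 'I_d}) :
  \sum_(k in D) cup fs (bumpv k v) (D :\ k) = \sum_(k in D) cup fs v (D :\ k).
Proof.
elim: fs v D => [//|f fs IH] v D /=.
pose W u k l := cup fs u (D :\ k :\ l).
have WC u k l : W u k l = W u l k by rewrite /W setD1C.
(* Both sides reduce to [S0]. The remaining terms, with [f] at the far corner on the left and [f] at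
   [v] on the right, are symmetric in [k] and [l] (on the right, after the induction hypothesis),
   hence vanish. *)
pose S0 := \sum_(k in D) \sum_(l in D :\ k) f (bumpv k v) * W (bumpv k v) k l.
transitivity S0.
  rewrite /S0.
  transitivity (\sum_(k in D) \sum_(l in D :\ k)
     f (bumpv l (bumpv k v)) * W (bumpv l (bumpv k v)) k l +
   \sum_(k in D) \sum_(l in D :\ k) f (bumpv k v) * W (bumpv l (bumpv k v)) k l).
    rewrite -big_split /=; apply: eq_bigr => k kD.
    rewrite -big_split /=; apply: eq_bigr => l lD.
    by rewrite F2_subr mulrDl.
  rewrite sum_symmetric0 ?add0r; last by move=> k l; rewrite bumpvC WC.
  by apply: eq_bigr => k kD; rewrite -!mulr_sumr IH.
transitivity (\sum_(k in D) \sum_(l in D :\ k) f (bumpv l v) * W (bumpv l v) k l +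
   \sum_(k in D) \sum_(l in D :\ k) f v * W (bumpv l v) k l); last first.
  rewrite -big_split /=; apply: eq_bigr => k kD.
  rewrite -big_split /=; apply: eq_bigr => l lD.
  by rewrite F2_subr mulrDl.
rewrite [X in _ + X](_ : _ = 0); last first.
  rewrite (eq_bigr (fun k => \sum_(l in D :\ k) f v * W v k l)); last first.
    by move=> k kD; rewrite -!mulr_sumr IH.
  by apply: sum_symmetric0 => k l; rewrite WC.
rewrite addr0 /S0 sum_pair_exchange.
by apply: eq_bigr => k kD; apply: eq_bigr => l lD; rewrite WC.
Qed.

(** All monotone paths of the expansion stay within the invariant [Q]. A function that is constant
    there contributes a zero difference to each product. *)
Lemma cup_const0 (Q : vertex -> {set 'I_d} -> Prop) fs v D (c : K) :
  (forall v D k, Q v D -> k \in D -> Q (bumpv k v) (D :\ k)) ->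
  (exists i, (i < size fs)%N /\ forall v D, Q v D -> nth (fun _ => 0) fs i v = c) ->
  Q v D -> cup fs v D = 0.
Proof.
move=> Qstep; elim: fs v D => [|f fs IH] v D [i [ilt fc]] Qv //=.
apply: big1 => k kD; case: i ilt fc => [|i] ilt fc.
  by rewrite [f v](fc _ _ Qv) [f _](fc _ _ (Qstep _ _ _ Qv kD)) subrr mul0r.
by rewrite IH ?mulr0 //; [exists i | exact: Qstep].
Qed.

Variable m : nat.
Local Notation box := {ffun 'I_d -> 'I_m.+1}.

(** The vertices of the grid have coordinates from 0 to [m.+1]. [corner D w] runs over the cells of
    the face where the coordinates outside [D] equal [m.+1]; [pinned] fixes the entries of [w] that
    do not matter, so that each cell is counted once. *)
Definition corner (D : {set 'I_d}) (w : box) : vertex :=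
  [ffun i => if i \in D then w i : nat else m.+1].
Definition pinned (D : {set 'I_d}) (w : box) := [forall i, (i \notin D) ==> (w i == ord0)].
Definition setc (k : 'I_d) (a : nat) (v : vertex) : vertex := [ffun i => if i == k then a else v i].
Definition setb (k : 'I_d) (a : 'I_m.+1) (w : box) : box := [ffun i => if i == k then a else w i].

(** The cells are arranged in lines parallel to [k]; along each line only the end values survive.
    The upper end is a corner for [D :\ k], precisely because [corner] puts the missing coordinates
    at [m.+1]. *)
Lemma sum_box_telescope (g : vertex -> K) (D : {set 'I_d}) k : k \in D ->
  \sum_(w : box | pinned D w) (g (bumpv k (corner D w)) - g (corner D w)) =
  \sum_(w : box | pinned (D :\ k) w) (g (corner (D :\ k) w) - g (setc k 0 (corner (D :\ k) w))).
Proof.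
move=> kD.
have -> : \sum_(w : box | pinned D w) (g (bumpv k (corner D w)) - g (corner D w)) =
  \sum_(w : box | pinned (D :\ k) w) \sum_(a < m.+1)
     (g (setc k a.+1 (corner (D :\ k) w)) - g (setc k a (corner (D :\ k) w))).
  rewrite pair_big_dep /=.
  rewrite (reindex_onto (fun p : box * 'I_m.+1 => setb k p.2 p.1)
     (fun w => (setb k ord0 w, w k))) /=; last first.
    by move=> w _; apply/ffunP => i; rewrite !ffunE; case: eqP => // ->.
  apply: eq_big => [[w a]|[w a]] /=.
    apply/andP/andP => [[/forallP pw /eqP[/ffunP ew _]]|[/forallP pw _]]; split => //.
    - apply/forallP => i; move: (pw i) (ew i); rewrite !inE !ffunE negb_and negbK.
      by case: (i =P k) => [_ _ <-|_ h _] /=; rewrite ?eqxx.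
    - apply/forallP => i; rewrite !ffunE; case: (_ =P k) => [->|/eqP ik]; first by rewrite kD.
      by move: (pw i); rewrite !inE ik.
    - apply/eqP; congr pair; last by rewrite ffunE eqxx.
      apply/ffunP => i; rewrite !ffunE; case: (_ =P k) => // ->.
      by move: (pw k); rewrite !inE eqxx /= => /eqP.
  move=> _; congr (g _ - g _); apply/ffunP => i; rewrite !ffunE !inE.
    by case: (_ =P k) => [->|_]; rewrite ?kD ?addn1 ?addn0.
  by case: (_ =P k) => [->|_]; rewrite ?kD.
apply: eq_bigr => w _.
rewrite (eq_bigr (fun a : 'I_m.+1 => g (setc k a.+1 (corner (D :\ k) w)) - g (setc k a (corner (D :\ k) w)))) //.
rewrite -(big_mkord xpredT (fun a => g (setc k a.+1 (corner (D :\ k) w)) - g (setc k a (corner (D :\ k) w)))).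
rewrite (telescope_sumr (fun a => g (setc k a (corner (D :\ k) w)))) //.
congr (g _ - g _); apply/ffunP => i; rewrite !ffunE !inE.
by case: eqP.
Qed.

Variable lam : 'I_d -> vertex -> K.
Hypothesis lam0 : forall (k : 'I_d) (v : vertex), v k = 0%N -> lam k v = 0.
Hypothesis lam1 : forall (k : 'I_d) (v : vertex), v k = m.+1 -> lam k v = 1.

(** The paths never move in a direction outside [D], so the coordinate [k] remains [c] and [lam k]
    is constant along them. *)
Lemma cup_face0 (ks : seq 'I_d) (k : 'I_d) c e (v : vertex) (D : {set 'I_d}) : uniq ks -> k \in ks -> k \notin D ->
  v k = c -> (forall u : vertex, u k = c -> lam k u = e) -> cup (map lam ks) v D = 0.
Proof.
move=> uks kks kD vk le.
apply: (@cup_const0 (fun (v : vertex) (D : {set 'I_d}) => v k = c /\ k \notin D) _ _ _ e) => //.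
- move=> u E l [uk kE] lE; split; last by rewrite !inE (negbTE kE) andbF.
  rewrite ffunE uk; case: eqP => [kl|_]; last by rewrite addn0.
  by rewrite kl lE in kE.
- exists (index k ks); rewrite size_map index_mem; split => // u E [uk _].
  by rewrite (nth_map k) ?index_mem // nth_index //; exact: le.
Qed.

(** Stokes, by induction on the dimension. [cup_closed] lets the first coboundary be written as a
    difference of values of [g], and the sum telescopes to the boundary. For [k] other than [k0]
    both faces contribute 0, as [lam k] is constant on them; so does the lower face for [k0], where
    [lam k0] is 0. The upper face for [k0] carries the same sum for [ks]. *)
Lemma sum_cup1 (ks : seq 'I_d) : uniq ks ->
  \sum_(w : box | pinned [set k in ks] w) cup (map lam ks) (corner [set k in ks] w) [set k in ks] = 1.
Proof.
elim: ks => [_|k0 ks IH] /=.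
  rewrite (big_pred1 [ffun=> ord0]) // => w /=; apply/forallP/eqP => [pw|-> i].
    by apply/ffunP => i; move: (pw i); rewrite !inE ffunE /= => /eqP.
  by rewrite ffunE eqxx implybT.
move=> /andP[k0ks uks]; set D := [set k in k0 :: ks].
have Dk0 : D :\ k0 = [set k in ks].
  apply/setP => i; rewrite !inE; case: eqP => [->|//] /=.
  by rewrite (negbTE k0ks).
pose g k v := lam k0 v * cup (map lam ks) v (D :\ k).
transitivity (\sum_(w | pinned D w) \sum_(k in D) (g k (bumpv k (corner D w)) - g k (corner D w))).
  apply: eq_bigr => w _; under eq_bigr do rewrite mulrBl.
  rewrite !sumrB -!mulr_sumr; congr (_ - _ * _).
  exact: cup_closed.
rewrite exchange_big /=.
under eq_bigr => k kD do rewrite sum_box_telescope //.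
rewrite (bigD1 k0) /=; last by rewrite !inE eqxx.
rewrite [X in _ + X]big1 ?addr0; last first.
  move=> k /andP[kD kk0]; apply: big1 => w _; rewrite /g.
  have kks : k \in ks by move: kD; rewrite !inE (negbTE kk0).
  rewrite (@cup_face0 _ k m.+1 1) //; first 1 last.
  - by rewrite !inE eqxx.
  - by rewrite !ffunE !inE eqxx.
  - exact: lam1.
  rewrite (@cup_face0 _ k 0%N 0) ?mulr0 ?subr0 //.
  - by rewrite !inE eqxx.
  - by rewrite !ffunE eqxx.
  - exact: lam0.
rewrite -[RHS](IH uks) -Dk0; apply: eq_bigr => w _; rewrite /g.
rewrite lam1 ?mul1r; last by rewrite !ffunE !inE eqxx.
by rewrite lam0 ?mul0r ?subr0 // !ffunE eqxx.
Qed.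

(** The total being 1, some cell has a nonzero cup product. On its vertices no [lam k] can be
    constant, or the product would vanish by [cup_const0]. *)
Lemma kuhn_F2 : exists w : box, forall k, exists x y : vertex,
  [/\ (forall i, w i <= x i <= (w i).+1)%N, (forall i, w i <= y i <= (w i).+1)%N,
     lam k x = 0 & lam k y = 1].
Proof.
have := sum_cup1 (enum_uniq 'I_d); set D := [set k in enum 'I_d].
have DT i : i \in D by rewrite inE mem_enum.
have [/existsP[w wU] _|/existsPn allU] := boolP [exists w, cup (map lam (enum 'I_d)) (corner D w) D != 0]; last first.
  by rewrite big1 => [/eqP //|w _]; apply/eqP; move: (allU w); rewrite negbK.
exists w => k; apply: contrapT => nex; apply: (elimN eqP wU).
(* The vertices of the cell [w] reached once the directions outside [E] have been used. *)
pose Q (v : vertex) (E : {set 'I_d}) := forall i, v i = (w i + (i \notin E))%N.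
have Qin v E : Q v E -> forall i, (w i <= v i <= (w i).+1)%N.
  by move=> Qv i; rewrite Qv; case: (_ \notin _); rewrite ?addn1 ?addn0 ?leqnn ?leqnSn.
have Qw : Q (corner D w) D by move=> i; rewrite ffunE DT addn0.
apply: (@cup_const0 Q _ _ _ (lam k (corner D w))) => //.
- move=> v E l Qv lE i; rewrite ffunE Qv !inE negb_and negbK.
  by case: eqP => [->|]; rewrite ?lE ?addn0 //= addn0.
- exists k; rewrite size_map size_enum_ord; split => // v E Qv.
  rewrite (nth_map k) ?size_enum_ord // nth_ord_enum.
  have F2P (a : 'F_2) : a = 0 \/ a = 1.
    by case: a => [[|[|//]]] ?; [left|right]; apply: val_inj.
  have [ev|ev] := F2P (lam k v); have [ec|ec] := F2P (lam k (corner D w));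
    rewrite ?ev ?ec //; exfalso; apply: nex.
    by exists v, (corner D w); split; eauto.
  by exists (corner D w), v; split; eauto.
Qed.

End CupProduct.

Lemma kuhn_cubical (d m : nat) (lam : 'I_d -> {ffun 'I_d -> nat} -> bool) :
  (forall k (v : {ffun _}), v k = 0%N -> lam k v = false) ->
  (forall k (v : {ffun _}), v k = m.+1 -> lam k v = true) ->
  exists w : {ffun 'I_d -> 'I_m.+1}, forall k, exists x y : {ffun 'I_d -> nat},
  [/\ (forall i, w i <= x i <= (w i).+1)%N, (forall i, w i <= y i <= (w i).+1)%N,
     lam k x = false & lam k y = true].
Proof.
move=> l0 l1.
have [|k v vk|w wP] := @kuhn_F2 d m (fun k v => (lam k v)%:R).
- by move=> k v vk; rewrite l0.
- by rewrite l1.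
exists w => k; have [x [y [xw yw lx ly]]] := wP k; exists x, y; split => //.
  by case: (lam k x) lx.
by case: (lam k y) ly.
Qed.

Local Open Scope classical_set_scope.
Local Open Scope ring_scope.

(** * The Poincaré-Miranda theorem *)

Section PoincareMiranda.
Context {R : realType} {d : nat}.
Implicit Types (x y v : 'rV[R]_d).

(** Compactness of the cube, which turns approximate solutions into exact ones both in the
    Poincaré-Miranda theorem and in the measurability of projections. *)
Lemma cube_cluster (v : nat -> 'rV[R]_d) :
  (forall r k, -1 <= v r 0 k <= 1) ->
  exists x, (forall k, -1 <= x 0 k <= 1) /\
    forall A, nbhs x A -> forall M, exists2 r, (M <= r)%N & A (v r).
Proof.
move=> v11.
have := @rV_compact R d (fun _ => `[-1, 1]%classic) (fun _ => @segment_compact _ _ _).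
move=> /(_ (v @ \oo) _) [].
  by exists 0%N => // r _ k; rewrite /= in_itv /=; exact: v11.
move=> x [x11 cx]; exists x; split.
  by move=> k; move: (x11 k); rewrite /= in_itv.
move=> A nA M.
have [|y [[r /= Mr <-] Ay]] := cx (v @` [set r | (M <= r)%N]) A _ nA.
  by exists M => // r /= Mr; exists r.
by exists r.
Qed.

Definition grid_point m (u : {ffun 'I_d -> nat}) : 'rV[R]_d :=
  \row_k (-1 + (u k)%:R * (2 / m.+1%:R)).

Lemma poincare_miranda (f : 'I_d -> 'rV[R]_d -> R) :
  (forall k, continuous (f k)) ->
  (forall k x, x 0 k = -1 -> f k x <= 0) ->
  (forall k x, x 0 k = 1 -> 0 <= f k x) ->
  exists x, (forall k, -1 <= x 0 k <= 1) /\ forall k, f k x = 0.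
Proof.
move=> cf fm fp.
(* The values on the two faces are imposed: [f k] may vanish where the coordinate is -1, and its
   sign alone would then give [true]. The weak inequalities [lamf] and [lamt] still hold there, by
   the boundary hypotheses. *)
pose lam m k (u : {ffun 'I_d -> nat}) :=
  if u k == 0%N then false else if u k == m.+1 then true else 0 <= f k (grid_point m u).
have lamf m k u : lam m k u = false -> f k (grid_point m u) <= 0.
  rewrite /lam; case: eqP => [u0 _|_].
    by apply: fm; rewrite !mxE u0 mul0r addr0.
  by case: eqP => // _ /negbT; rewrite -ltNge => /ltW.
have lamt m k u : lam m k u = true -> 0 <= f k (grid_point m u).
  rewrite /lam; case: eqP => // _; case: eqP => // um _.
  by apply: fp; rewrite !mxE um mulrCA divff ?pnatr_eq0 // mulr1; lra.
have /choice[w wP] : forall m, exists w : {ffun 'I_d -> nat},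
   (forall i, (w i <= m)%N) /\ forall k, exists x y : {ffun 'I_d -> nat},
  [/\ (forall i, w i <= x i <= (w i).+1)%N, (forall i, w i <= y i <= (w i).+1)%N,
     f k (grid_point m x) <= 0 & 0 <= f k (grid_point m y)].
  move=> m.
  have [|k v vk|w wP] := @kuhn_cubical d m (lam m).
  - by move=> k v vk; rewrite /lam vk.
  - by rewrite /lam vk eqxx.
  exists [ffun i => w i : nat]; split; first by move=> i; rewrite ffunE -ltnS.
  move=> k; have [x [y [xw yw lx ly]]] := wP k; exists x, y; split.
  - by move=> i; rewrite ffunE.
  - by move=> i; rewrite ffunE.
  - exact: lamf.
  - exact: lamt.
have [|x [x11 xcl]] := @cube_cluster (fun m => grid_point m (w m)).
  move=> m k; rewrite mxE.
  have h2 : 0 < 2 / m.+1%:R :> R by rewrite divr_gt0.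
  have : (w m k)%:R * (2 / m.+1%:R) <= 2 :> R.
    rewrite mulrA ler_pdivrMr // mulrC ler_pM2l // ler_nat.
    by apply: leqW; exact: (wP m).1.
  have : 0 <= (w m k)%:R * (2 / m.+1%:R) :> R by rewrite mulr_ge0 // ltW.
  by move: (_ * (2 / _)) => t t0 t2; apply/andP; split; lra.
exists x; split => // k.
(* every neighbourhood of the cluster point contains a whole Kuhn cell *)
have cell (A : set 'rV[R]_d) : nbhs x A -> exists m, forall u : {ffun 'I_d -> nat},
    (forall i, w m i <= u i <= (w m i).+1)%N -> A (grid_point m u).
  move=> /nbhs_ballP[e /= e0 eA].
  have [M _ MP] := near_infty_natSinv_lt (PosNum (divr_gt0 e0 (ltr0n R 8))).
  have [|m Mm vm] := xcl (ball x (e / 2)) _ M.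
    by apply: nbhsx_ballx; rewrite divr_gt0.
  exists m => u uw; apply: eA; split=> // i j.
  have [_ /(_ i j)] := vm; rewrite /ball /= !mxE !ord1.
  move=> vmj.
  have mm : 2 / m.+1%:R < e / 4 :> R.
    by have : m.+1%:R^-1 < e / 8 :> R := MP _ Mm; move: _^-1 => t te; lra.
  have m0 : 0 < 2 / m.+1%:R :> R by rewrite divr_gt0.
  have [u1 u2] : ((w m j)%:R <= (u j)%:R :> R) /\ ((u j)%:R <= (w m j)%:R + 1 :> R).
    by have /andP[? ?] := uw j; rewrite natr1 !ler_nat.
  move: (w m j)%:R (u j)%:R (2 / _) u1 u2 mm m0 vmj => a b c ab ba ce c0.
  have ac : a * c <= b * c by rewrite ler_pM2r.
  have bc : b * c <= a * c + c by rewrite -[X in _ + X]mul1r -mulrDl ler_pM2r.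
  move: (a * c) (b * c) ac bc => p q pq qp; rewrite !ltr_norml => /andP[h1 h2].
  by apply/andP; split; lra.
apply/eqP; rewrite eq_le !leNgt; apply/andP; split; apply/negP => fk.
- have [|m mP] := cell [set y | 0 < f k y].
    exact: (cf k x _ (lt_nbhsr fk)).
  have [a [b [aw _ fa _]]] := (wP m).2 k.
  by have := mP a aw; rewrite /= ltNge fa.
- have [|m mP] := cell [set y | f k y < 0].
    exact: (cf k x _ (lt_nbhsl fk)).
  have [a [b [_ bw _ fb]]] := (wP m).2 k.
  by have := mP b bw; rewrite /= ltNge fb.
Qed.

End PoincareMiranda.

(** * Hex for Voronoi cells *)

Section SquaredDistance.
Context {R : realType} {d : nat}.
Implicit Types (x y p q : d.-tuple R).

(** Squaring preserves comparisons of distances, and the difference of the squared distances to two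
    centers is affine in the point; the convexity arguments below rest on this. *)
Definition sqdist x y : R := \sum_(k < d) (tnth x k - tnth y k) ^+ 2.

Lemma sqdist_ge0 x y : 0 <= sqdist x y.
Proof. by apply: sumr_ge0 => k _; exact: sqr_ge0. Qed.

Lemma edist_le x p q : (Defs.edist x p <= Defs.edist x q) = (sqdist x p <= sqdist x q).
Proof. by rewrite ler_sqrt // sqdist_ge0. Qed.

Definition row_tuple (v : 'rV[R]_d) : d.-tuple R := [tuple v 0 k | k < d].

Lemma tnth_row v k : tnth (row_tuple v) k = v 0 k.
Proof. by rewrite tnth_mktuple. Qed.

Lemma continuous_mulBmul (T : topologicalType) (f g h e : T -> R) :
  continuous f -> continuous g -> continuous h -> continuous e ->
  continuous (fun z => f z * g z - h z * e z).
Proof.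
move=> cf cg ch ce z.
by apply: (@continuousB _ _ _ (f \* g) (h \* e)); apply: continuousM; [exact: cf|exact: cg|exact: ch|exact: ce].
Qed.

Lemma continuous_coordB (k : 'I_d) (c : R) : continuous (fun v : 'rV[R]_d => v 0 k - c).
Proof. by move=> v; apply: continuousB; [exact: coord_continuous | exact: cst_continuous]. Qed.

Lemma continuous_coordB_sqr (k : 'I_d) (c : R) :
  continuous (fun v : 'rV[R]_d => (v 0 k - c) ^+ 2).
Proof.
move=> v; apply: (@continuous_comp _ _ _ (fun v : 'rV[R]_d => v 0 k - c) (fun t => t ^+ 2)).
  exact: continuous_coordB.
exact: exprn_continuous.
Qed.

Lemma continuous_sqdist p : continuous (fun v => sqdist (row_tuple v) p).
Proof.
rewrite /sqdist; apply: (continuous_big add_continuous) => k _.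
by under eq_fun do rewrite tnth_row; exact: continuous_coordB_sqr.
Qed.

End SquaredDistance.

Section HexVoronoi.
Context {R : realType} {d : nat} (n : nat) (p : nat -> d.-tuple R).
Implicit Types (x : d.-tuple R).

Definition near_center (i : nat) : set (d.-tuple R) :=
  [set x | cube x /\ forall j, (j < n)%N -> sqdist x (p i) <= sqdist x (p j)].

Lemma voronoi_cellE i : voronoi_cell [set p j | j in `I_n] (p i) = near_center i.
Proof.
apply/seteqP; split => x [cx nx]; split => //.
  by move=> j jn; rewrite -edist_le; apply: nx; exists j.
by move=> _ [j /= jn <-]; rewrite edist_le; exact: nx.
Qed.

Definition touching (i j : nat) : Prop := near_center i `&` near_center j !=set0.

(** A continuous nonnegative function whose zeros in the cube form the cell [i]: each [a + |a|] is
    twice the positive part of [a]. *)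
Definition excess (i : nat) x : R :=
  \sum_(l < n) ((sqdist x (p i) - sqdist x (p l)) + `|sqdist x (p i) - sqdist x (p l)|).

Lemma excess_ge0 i x : 0 <= excess i x.
Proof.
apply: sumr_ge0 => l _; have := ler_norm (- (sqdist x (p i) - sqdist x (p l))).
rewrite normrN; lra.
Qed.

Lemma excess0 i x : cube x -> excess i x = 0 <-> near_center i x.
Proof.
move=> cx; split => [e0|[_ ix]].
  split => // j jn; have /eqP := e0; rewrite psumr_eq0; last first.
    move=> l _; have := ler_norm (- (sqdist x (p i) - sqdist x (p l))).
    by rewrite normrN; lra.
  move=> /allP /(_ (Ordinal jn)); rewrite mem_index_enum => /(_ isT) /= /eqP h.
  by have := normr_ge0 (sqdist x (p i) - sqdist x (p j)); lra.
apply: big1 => l _; have := ix l (ltn_ord l) => h.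
by rewrite ler0_norm ?subrr // subr_le0.
Qed.

Lemma continuous_excess i : continuous (fun v => excess i (row_tuple v)).
Proof.
apply: (continuous_big add_continuous) => l _.
pose g (v : 'rV[R]_d) := sqdist (row_tuple v) (p i) - sqdist (row_tuple v) (p l).
have cg : continuous g by move=> u; apply: continuousB; exact: continuous_sqdist.
have cn : continuous (fun v => g v + `|g v|).
  move=> u; apply: continuousD; first exact: cg.
  by apply: continuous_comp; [exact: cg | exact: norm_continuous].
exact: cn.
Qed.

Lemma exists_near_center x : (0 < n)%N -> cube x -> exists2 i, (i < n)%N & near_center i x.
Proof.
move=> n0 cx.
have [i _ imin] := @arg_minP _ _ _ (Ordinal n0) xpredT (fun l => sqdist x (p l)) isT.
by exists i => //; split => // j jn; exact: (imin (Ordinal jn) isT).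
Qed.

(** If no chain exists, the cells of color [k] split into those joined to the face [x_k = -1]
    ([left k]) and the others. [f k] is the difference of two products: the first vanishes on the
    face [x_k = -1] and on the left cells, the second on the face [x_k = 1] and on the other cells
    of color [k]. At a zero of [f k], if one product vanishes then so does the other. *)
Lemma hex_touching (col : nat -> 'I_d) : (0 < n)%N -> exists (k : 'I_d) i c,
  [/\ all (fun j => (j < n)%N && (col j == k)) (i :: c),
      path (fun j l => `[< touching j l >]) i c,
      near_center i `&` cube_face k true !=set0 &
      near_center (last i c) `&` cube_face k false !=set0].
Proof.
move=> n0; apply: contrapT => nohex.
pose left k j := exists i c, [/\ all (fun j => (j < n)%N && (col j == k)) (i :: c),
      path (fun j l => `[< touching j l >]) i c,
      near_center i `&` cube_face k true !=set0 & last i c = j].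
have left_touch k i j : left k i -> touching i j -> (j < n)%N -> col j = k -> left k j.
  move=> [i0 [c [call cpath i0f <-]]] tij jn jk; exists i0, (rcons c j); split => //.
  - by rewrite -rcons_cons all_rcons jn jk eqxx.
  - by rewrite rcons_path cpath; apply/asboolP.
  - by rewrite last_rcons.
(* At a common zero of the [f k], the color of a nearest center yields a cell on the
   left side of its color class touching one on the right side. *)
pose f k (v : 'rV[R]_d) :=
  (v 0 k + 1) * \prod_(i < n | `[< col i = k /\ left k i >]) excess i (row_tuple v)
  - (1 - v 0 k) * \prod_(i < n | `[< col i = k /\ ~ left k i >]) excess i (row_tuple v).
have [|k v vk|k v vk|v [v11 fv]] := @poincare_miranda R d f.
- move=> k; apply: continuous_mulBmul.
  + by move=> v; apply: continuousD; [exact: coord_continuous | exact: cst_continuous].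
  + by apply: (continuous_big mul_continuous) => i _; exact: continuous_excess.
  + by move=> v; apply: continuousB; [exact: cst_continuous | exact: coord_continuous].
  + by apply: (continuous_big mul_continuous) => i _; exact: continuous_excess.
- rewrite /f vk addNr mul0r sub0r oppr_le0; apply: mulr_ge0; first lra.
  by apply: prodr_ge0 => i _; exact: excess_ge0.
- rewrite /f vk subrr mul0r subr0; apply: mulr_ge0; first lra.
  by apply: prodr_ge0 => i _; exact: excess_ge0.
set x := row_tuple v.
have cx : cube x by move=> k; rewrite tnth_row.
have [i ilt xi] := exists_near_center n0 cx.
pose k := col i; have ek : col i = k by [].
have face (s : bool) : v 0 k = (-1) ^+ s -> cube_face k s x by move=> e; split; rewrite ?tnth_row.
have /eqP := fv k; rewrite /f subr_eq0 => /eqP fk.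
have zprod (P : pred 'I_n) (j : 'I_n) : P j -> near_center j x ->
    \prod_(i < n | P i) excess i x = 0.
  by move=> Pj /(excess0 _ cx).2 jx; rewrite (bigD1 j) //= jx mul0r.
have prodz (P : pred 'I_n) : \prod_(i < n | P i) excess i x = 0 ->
    exists2 j : 'I_n, P j & near_center j x.
  move=> /eqP; rewrite prodf_seq_eq0 => /hasP[j _ /andP[Pj /eqP /(excess0 _ cx).1 jx]].
  by exists j.
have [il|nil] := pselect (left k i).
- move: fk; rewrite (zprod (fun i => `[< _ /\ left k _ >]) (Ordinal ilt)) //; last exact/asboolP.
  rewrite mulr0 => /esym/eqP; rewrite mulf_eq0 => /orP[|/eqP /prodz[j /asboolP[jk nj] xj]].
    rewrite subr_eq0 => /eqP vk; apply: nohex.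
    have [i0 [c [call cpath i0f ei]]] := il.
    exists k, i0, c; split => //; rewrite ei; exists x; split => //; exact: (face false).
  by apply: nj; apply: left_touch il _ _ _ => //; exists x.
- apply: (nil); move: fk.
  rewrite [X in _ = _ * X](zprod (fun i => `[< _ /\ ~ left k _ >]) (Ordinal ilt)) //; last exact/asboolP.
  rewrite mulr0 => /eqP; rewrite mulf_eq0 => /orP[|/eqP /prodz[j /asboolP[jk lj] xj]].
    rewrite addr_eq0 => /eqP vk; exists i, [::]; split => //=.
      by rewrite ilt ek eqxx.
    by exists x; split => //; apply: (face true); rewrite vk.
  by apply: left_touch lj _ _ _ => //; exists x.
Qed.

End HexVoronoi.

(** * Facets of Voronoi cells *)

Section AffineGeometry.
Context {R : realType} {d : nat}.
Implicit Types (x y p q : d.-tuple R).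

Definition mix (t : R) x y : d.-tuple R := [tuple (1 - t) * tnth x k + t * tnth y k | k < d].

Lemma tnth_mix t x y k : tnth (mix t x y) k = (1 - t) * tnth x k + t * tnth y k.
Proof. by rewrite tnth_mktuple. Qed.

(** The terms quadratic in the point cancel in the difference. *)
Lemma sqdist_mix t x y p q :
  sqdist (mix t x y) p - sqdist (mix t x y) q =
  (1 - t) * (sqdist x p - sqdist x q) + t * (sqdist y p - sqdist y q).
Proof.
rewrite /sqdist -!sumrB !mulr_sumr -big_split /=; apply: eq_bigr => k _.
by rewrite tnth_mix; ring.
Qed.

Lemma sqdist_translate x y p q :
  (sqdist x p - sqdist x q) - (sqdist y p - sqdist y q) =
  2 * \sum_(k < d) (tnth x k - tnth y k) * (tnth q k - tnth p k).
Proof.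
by rewrite /sqdist -!sumrB mulr_sumr; apply: eq_bigr => k _; ring.
Qed.

Lemma sqdist_eq0 x y : sqdist x y = 0 -> x = y.
Proof.
move=> /eqP; rewrite psumr_eq0; last by move=> k _; exact: sqr_ge0.
move=> /allP h; apply: eq_from_tnth => k.
by have := h k (mem_index_enum _); rewrite /= sqrf_eq0 subr_eq0 => /eqP.
Qed.

Lemma sqdistxx x : sqdist x x = 0.
Proof. by apply: big1 => k _; rewrite subrr expr0n. Qed.

Lemma sqdist_gt0 x y : x <> y -> 0 < sqdist x y.
Proof. by move=> xy; rewrite lt_def sqdist_ge0 andbT; apply/eqP => /sqdist_eq0. Qed.

(** A pair [(a, b)] stands for the affine function [a + e * b] of [e]: finitely many strict
    inequalities valid at [e = 0] persist for a common [e > 0]. Perturbation arguments list their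
    constraints in this form; [e < 1] keeps the perturbed point on a segment. *)
Lemma small_parameter (s : seq (R * R)) : (forall c, c \in s -> c.1 < 0) ->
  exists2 e, 0 < e < 1 & forall c, c \in s -> c.1 + e * c.2 < 0.
Proof.
elim: s => [|i s IH] ais; first by exists 2^-1 => //; lra.
have [|e /andP[e0 e1] eP] := IH; first by move=> j js; apply: ais; rewrite in_cons js orbT.
have ai : i.1 < 0 by apply: ais; rewrite mem_head.
pose m := 1 + `|i.2|; have m0 : 0 < m by rewrite /m; have := normr_ge0 (i.2); lra.
(* With this bound [e' * i.2 <= e' * m <= - i.1 / 2], which leaves half of the margin. *)
pose e' := Num.min e (- i.1 / (2 * m)).
have e'0 : 0 < e'.
  by rewrite lt_min e0 /= divr_gt0 ?mulr_gt0 // oppr_gt0.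
have e'e : e' <= e by rewrite ge_min lexx.
exists e'; first by rewrite e'0 (le_lt_trans e'e).
move=> j; rewrite in_cons => /orP[/eqP ->|js].
  have : e' * (2 * m) <= - i.1.
    by rewrite -ler_pdivlMr ?mulr_gt0 // ge_min lexx orbT.
  have : e' * i.2 <= e' * m.
    by rewrite ler_pM2l // /m; have := ler_norm (i.2); lra.
  have : 0 < e' * m by rewrite mulr_gt0.
  by rewrite (mulrCA e'); lra.
have [bj|bj] := leP (j.2) 0.
  have : e' * j.2 <= 0 by rewrite mulr_ge0_le0 // ltW.
  by have := ais j; rewrite in_cons js orbT => /(_ isT); lra.
have := eP j js; have : e' * j.2 <= e * j.2 by rewrite ler_pM2r.
lra.
Qed.

(** The rows of [M] span a hyperplane, whose orthogonal is a line. *)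
Lemma orthogonal_line (M : 'M[R]_(d.-1, d)) (u v : 'rV[R]_d) : (0 < d)%N ->
  row_free M -> u != 0 -> M *m u^T = 0 -> M *m v^T = 0 -> exists c, v = c *: u.
Proof.
move=> d0 fM u0 Mu Mv.
have inker (w : 'rV[R]_d) : M *m w^T = 0 -> (w <= kermx M^T)%MS.
  by move=> Mw; apply/sub_kermxP; rewrite -[w *m _]trmxK trmx_mul trmxK Mw trmx0.
have rk : \rank (kermx M^T) = 1%N.
  by rewrite mxrank_ker mxrank_tr (eqP fM) -{1}(prednK d0) subSnn.
have : (u == kermx M^T)%MS.
  by rewrite -(geq_leqif (mxrank_leqif_eq (inker _ Mu))) rk rank_rV u0.
by move=> /eqmxP h; apply/sub_rVP; rewrite h; exact: inker.
Qed.

Lemma orthogonal_full (n : nat) (M : 'M[R]_(n, d)) (u : 'rV[R]_d) :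
  n = d -> row_free M -> M *m u^T = 0 -> u = 0.
Proof.
move=> nd fM Mu.
have : (u <= kermx M^T)%MS.
  by apply/sub_kermxP; rewrite -[u *m _]trmxK trmx_mul trmxK Mu trmx0.
have : \rank (kermx M^T) = 0%N by rewrite mxrank_ker mxrank_tr (eqP fM) nd subnn.
by move=> /eqP; rewrite mxrank_eq0 => /eqP ->; rewrite submx0 => /eqP.
Qed.

Lemma orthogonal_basis (u : 'rV[R]_d) : (0 < d)%N -> u != 0 ->
  exists2 M : 'M[R]_(d.-1, d), row_free M & M *m u^T = 0.
Proof.
move=> d0 u0; have rk : \rank (kermx u^T) = d.-1.
  by rewrite mxrank_ker mxrank_tr rank_rV u0 subn1.
exists (castmx (rk, erefl) (row_base (kermx u^T))).
  by rewrite row_free_castmx row_base_free.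
case: _ / rk => /=; apply/sub_kermxP.
by rewrite castmx_id eq_row_base.
Qed.

End AffineGeometry.

Section StrictFacets.
Context {R : realType} {d : nat} (n : nat) (p : nat -> d.-tuple R).
Implicit Types (x : d.-tuple R).

(* [x] lies in the relative interior of the common facet of the cells [i] and [j]. *)
Definition strict_facet_point (i j : nat) x : Prop :=
  [/\ forall k, -1 < tnth x k < 1, sqdist x (p i) = sqdist x (p j) &
      forall l, (l < n)%N -> l != i -> l != j -> sqdist x (p i) < sqdist x (p l)].

Hypothesis p_inj : forall i j, (i < n)%N -> (j < n)%N -> p i = p j -> i = j.
Hypothesis p_cube : forall i, (i < n)%N -> cube (p i).

Variables i j : nat.
Hypotheses (ilt : (i < n)%N) (jlt : (j < n)%N) (ij : i != j).

Let u : 'rV[R]_d := \row_k (tnth (p j) k - tnth (p i) k).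

Let u_neq0 : u != 0.
Proof.
apply: contra_neq ij => u0; apply: p_inj => //; apply: eq_from_tnth => k.
by have /rowP /(_ k) := u0; rewrite !mxE => /eqP; rewrite subr_eq0 => /eqP.
Qed.

(** The supporting hyperplane is the bisector of the two centers; [E] says that its equation is the
    difference of the squared distances. *)
Lemma is_face_touching a b : (a < n)%N -> (b < n)%N ->
  is_face (near_center n p a `&` near_center n p b) (near_center n p a).
Proof.
move=> an bn.
exists [tuple 2 * (tnth (p b) k - tnth (p a) k) | k < d],
  (\sum_(k < d) (tnth (p b) k ^+ 2 - tnth (p a) k ^+ 2)).
have E x : \sum_(k < d) tnth [tuple 2 * (tnth (p b) k - tnth (p a) k) | k < d] k * tnth x k -
    \sum_(k < d) (tnth (p b) k ^+ 2 - tnth (p a) k ^+ 2) = sqdist x (p a) - sqdist x (p b).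
  by rewrite /sqdist -!sumrB; apply: eq_bigr => k _; rewrite tnth_mktuple; ring.
split=> [x [_ xa]|]; first by rewrite -subr_le0 E subr_le0 xa.
apply/seteqP; split => x [xa xb]; split => //=.
  by apply/eqP; rewrite -subr_eq0 E subr_eq0 eq_le xa.2 // xb.2.
move: xb => /eqP; rewrite -subr_eq0 E subr_eq0 => /eqP xb.
by split=> [|l ln]; [exact: xa.1 | rewrite -xb; exact: xa.2].
Qed.

(** Small displacements of [x] along [d - 1] independent directions orthogonal to [u] keep the
    equation and all strict inequalities, so that with [x] itself they give [d] affinely independent
    common points. More are impossible, since all common points lie on the bisector. *)
Lemma strict_facet_share x : (0 < d)%N -> strict_facet_point i j x ->
  share_facet (near_center n p i) (near_center n p j).
Proof.
move=> d0 [xint xij xl].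
exists (near_center n p i `&` near_center n p j); split.
- exact: is_face_touching.
- by rewrite setIC; exact: is_face_touching.
have orth x' y : (near_center n p i `&` near_center n p j) x' ->
    (near_center n p i `&` near_center n p j) y ->
    \sum_(k < d) (tnth y k - tnth x' k) * u 0 k = 0.
  have eqij z : (near_center n p i `&` near_center n p j) z -> sqdist z (p i) - sqdist z (p j) = 0.
    by move=> [zi zj]; apply/eqP; rewrite subr_eq0 eq_le zi.2 // zj.2.
  move=> /eqij xe /eqij ye; have := sqdist_translate y x' (p i) (p j).
  rewrite xe ye subr0 => /esym/eqP; rewrite mulf_eq0 pnatr_eq0 /= => /eqP h; rewrite -[RHS]h.
  by apply: eq_bigr => k _; rewrite mxE.
split; last first.
  move=> q qF; apply/negP => /(orthogonal_full (u := u)) h.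
  have := u_neq0; rewrite h ?eqxx ?prednK //.
  apply/matrixP => a b; rewrite !mxE -[RHS](orth _ _ (qF ord0) (qF (lift ord0 a))).
  by apply: eq_bigr => k _; rewrite !mxE.
have [M fM Mu] := orthogonal_basis d0 u_neq0.
pose pt e (a : 'I_d.-1) : d.-tuple R := [tuple tnth x k + e * M a k | k < d].
have ptij e a : sqdist (pt e a) (p i) - sqdist (pt e a) (p j) = 0.
  have := sqdist_translate (pt e a) x (p i) (p j); rewrite xij subrr subr0 => ->.
  have /matrixP /(_ a 0) := Mu; rewrite !mxE => Mua.
  transitivity (2 * (e * \sum_k M a k * u^T k 0)); last by rewrite Mua !mulr0.
  congr (_ * _); rewrite mulr_sumr; apply: eq_bigr => k _.
  by rewrite tnth_mktuple !mxE; ring.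
have ptil e a l : sqdist (pt e a) (p i) - sqdist (pt e a) (p l) =
    (sqdist x (p i) - sqdist x (p l)) + e * (2 * \sum_(k < d) M a k * (tnth (p l) k - tnth (p i) k)).
  apply/eqP; rewrite [eqbRHS]addrC -subr_eq sqdist_translate [eqbRHS]mulrCA; apply/eqP; congr (_ * _).
  by rewrite mulr_sumr; apply: eq_bigr => k _; rewrite tnth_mktuple; ring.
(* The constraints to be kept: the other centers stay farther, and each coordinate stays below 1 and
   above -1. *)
pose s := [seq (sqdist x (p i) - sqdist x (p w.2),
                2 * \sum_(k < d) M w.1 k * (tnth (p w.2) k - tnth (p i) k))
          | w : 'I_d.-1 * 'I_n <- enum {: 'I_d.-1 * 'I_n} & (w.2 != i :> nat) && (w.2 != j :> nat)] ++
  [seq (tnth x w.2 - 1, M w.1 w.2) | w <- enum {: 'I_d.-1 * 'I_d}] ++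
  [seq (- 1 - tnth x w.2, - M w.1 w.2) | w <- enum {: 'I_d.-1 * 'I_d}].
have [|e /andP[e0 _] eP] := @small_parameter R s.
  move=> c; rewrite !mem_cat => /or3P[] /mapP[[a l]].
  - by rewrite mem_filter /= => /andP[/andP[li lj] _] ->; rewrite subr_lt0; exact: xl.
  - by move=> _ -> /=; have /andP[] := xint l; lra.
  - by move=> _ -> /=; have /andP[] := xint l; lra.
have ptF a : (near_center n p i `&` near_center n p j) (pt e a).
  have ptcube : cube (pt e a).
    move=> k; rewrite tnth_mktuple.
    have := eP (tnth x k - 1, M a k); have := eP (- 1 - tnth x k, - M a k).
    have h1 : (tnth x k - 1, M a k) \in s.
      rewrite !mem_cat; apply/orP; right; apply/orP; left.
      by apply/mapP; exists (a, k); rewrite ?mem_enum.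
    have h2 : (- 1 - tnth x k, - M a k) \in s.
      rewrite !mem_cat; apply/orP; right; apply/orP; right.
      by apply/mapP; exists (a, k); rewrite ?mem_enum.
    by move=> /(_ h2) /= ? /(_ h1) /= ?; apply/andP; split; lra.
  have eij : sqdist (pt e a) (p i) = sqdist (pt e a) (p j).
    by apply/eqP; rewrite -subr_eq0 ptij.
  have nl l : (l < n)%N -> sqdist (pt e a) (p i) <= sqdist (pt e a) (p l).
    move=> ln; have [->//|li] := eqVneq l i; have [->|lj] := eqVneq l j; first by rewrite eij.
    rewrite -subr_le0 ptil ltW //.
    apply: (eP (_, _)); rewrite !mem_cat; apply/orP; left; apply/mapP.
    by exists (a, Ordinal ln); rewrite // mem_filter /= li lj mem_enum.
  by split; split => // l ln; rewrite -?eij; exact: nl.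
exists (fun a => if unlift ord0 a is Some a' then pt e a' else x); split.
  move=> a; case: unliftP => [a' _|_]; first exact: ptF.
  have xcube : cube x by move=> k; have /andP[/ltW -> /ltW ->] := xint k.
  have nl l : (l < n)%N -> sqdist x (p i) <= sqdist x (p l).
    move=> ln; have [->//|li] := eqVneq l i; have [->|lj] := eqVneq l j; first by rewrite xij.
    by rewrite ltW // xl.
  by split; split => // l ln; rewrite -?xij; exact: nl.
rewrite /affinely_independent (_ : \matrix_(_, _) _ = e *: M).
  by rewrite /row_free mxrank_scale_nz ?lt0r_neq0 //; exact: fM.
apply/matrixP => a k; rewrite !mxE liftK unlift_none tnth_mktuple; ring.
Qed.

(** The witness is the barycenter of [d] affinely independent points of the facet. A weak inequality
    that is an equality at the barycenter is an equality at all these points, so its hyperplane is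
    the bisector of [p i] and [p j]; [tight_l] and [tight_k] exclude this. *)
Lemma share_strict_facet : (0 < d)%N ->
  share_facet (near_center n p i) (near_center n p j) -> exists x, strict_facet_point i j x.
Proof.
move=> d0 [F [[c [c0 [_ Fi]]] [c' [c0' [_ Fj]]] [[q [qF fM]] _]]].
have qi a : near_center n p i (q a) by have := qF a; rewrite Fi => -[].
have qj a : near_center n p j (q a) by have := qF a; rewrite Fj => -[].
have qij a : sqdist (q a) (p i) = sqdist (q a) (p j).
  by apply/eqP; rewrite eq_le (qi a).2 // (qj a).2.
rewrite /affinely_independent in fM; set M := (M in row_free M) in fM.
have Mu : M *m u^T = 0.
  apply/matrixP => a b; rewrite !mxE.
  have := sqdist_translate (q (lift ord0 a)) (q ord0) (p i) (p j).
  rewrite !qij !subrr => /esym/eqP; rewrite mulf_eq0 pnatr_eq0 /= => /eqP h; rewrite -[RHS]h.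
  by apply: eq_bigr => k _; rewrite !mxE.
pose z := q ord0.
have zu : 2 * \sum_k (tnth z k - tnth (p i) k) * u 0 k = \sum_k u 0 k ^+ 2.
  have : sqdist z (p i) - sqdist z (p j) = 0 by rewrite qij subrr.
  rewrite /sqdist -sumrB mulr_sumr => h; apply/eqP; rewrite -subr_eq0 -sumrB -[X in _ == X]h.
  by apply/eqP; apply: eq_bigr => k _; rewrite mxE; ring.
have U0 : \sum_k u 0 k ^+ 2 != 0.
  apply: contra u_neq0; rewrite psumr_eq0; last by move=> k _; exact: sqr_ge0.
  move=> /allP h; apply/eqP/rowP => k; apply/eqP.
  by have := h k (mem_index_enum _); rewrite /= sqrf_eq0 => /eqP ->; rewrite mxE.
(* Then [p l - p i = t u], and equidistance from [z] gives [t^2 = t]: only [p i] and [p j]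
   themselves remain. *)
have tight_l l : (l < n)%N -> (forall a, sqdist (q a) (p i) = sqdist (q a) (p l)) -> l = i \/ l = j.
  move=> ln qil.
  have [|t tP] := @orthogonal_line R d M u (\row_k (tnth (p l) k - tnth (p i) k)) d0 fM u_neq0 Mu.
    apply/matrixP => a b; rewrite !mxE.
    have := sqdist_translate (q (lift ord0 a)) (q ord0) (p i) (p l).
    rewrite !qil !subrr => /esym/eqP; rewrite mulf_eq0 pnatr_eq0 /= => /eqP h; rewrite -[RHS]h.
    by apply: eq_bigr => k _; rewrite !mxE.
  have plk k : tnth (p l) k = tnth (p i) k + t * u 0 k.
    by have /rowP /(_ k) := tP; rewrite !mxE => <-; ring.
  have : t ^+ 2 * (\sum_k u 0 k ^+ 2) = t * (\sum_k u 0 k ^+ 2).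
    rewrite -{2}zu !mulr_sumr; apply/eqP; rewrite -subr_eq0 -sumrB.
    have : sqdist z (p l) - sqdist z (p i) = 0 by rewrite qil subrr.
    rewrite /sqdist -sumrB => h; rewrite -[X in _ == X]h.
    by apply/eqP; apply: eq_bigr => k _; rewrite plk; ring.
  move=> /eqP; rewrite -subr_eq0 -mulrBl mulf_eq0 (negbTE U0) orbF expr2 -{3}[t]mulr1 -mulrBr.
  rewrite mulf_eq0 subr_eq0 => /orP[] /eqP te; [left|right]; apply: p_inj => //.
    by apply: eq_from_tnth => k; rewrite plk te mul0r addr0.
  by apply: eq_from_tnth => k; rewrite plk te mul1r !mxE; ring.
(* Then [u] is parallel to the axis [k] and the bisector is the hyperplane of a face of the cube. It
   passes midway between two centers of the cube, whose coordinates [k] would then both equal [s],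
   although [u 0 k] is nonzero. *)
have tight_k k (s : R) : s ^+ 2 = 1 -> (forall a, tnth (q a) k = s) -> False.
  move=> s1 qk.
  have [|t tP] := @orthogonal_line R d M u (delta_mx 0 k) d0 fM u_neq0 Mu.
    apply/matrixP => a b; rewrite mxE (bigD1 k) //= big1 ?addr0; last first.
      by move=> l lk; rewrite !mxE (negbTE lk) andbF mulr0.
    by rewrite !mxE !qk subrr mul0r.
  have tu : t * u 0 k = 1.
    by have /rowP /(_ k) := tP; rewrite mxE [RHS]mxE !eqxx /= => <-.
  have zk : \sum_k (tnth z k - tnth (p i) k) * u 0 k * t = s - tnth (p i) k.
    rewrite (bigD1 k) //= big1 ?addr0; last first.
      move=> l lk; rewrite -mulrA [u 0 l * t]mulrC; have /rowP /(_ l) := tP.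
      by rewrite mxE [RHS]mxE (negbTE lk) andbF => <-; rewrite mulr0.
    by rewrite -mulrA [u 0 k * t]mulrC tu mulr1 /z qk.
  have uk : \sum_k u 0 k ^+ 2 * t = u 0 k.
    rewrite (bigD1 k) //= big1 ?addr0; last first.
      move=> l lk; rewrite expr2 -mulrA [u 0 l * t]mulrC; have /rowP /(_ l) := tP.
      by rewrite mxE [RHS]mxE (negbTE lk) andbF => <-; rewrite mulr0.
    by rewrite expr2 -mulrA [u 0 k * t]mulrC tu mulr1.
  have : 2 * (s - tnth (p i) k) = u 0 k by rewrite -zk -uk -!mulr_suml mulrA zu.
  have : s = 1 \/ s = -1 by move/eqP: s1; rewrite sqrf_eq1 => /orP[] /eqP; [left|right].
  have : u 0 k != 0 by apply: contra_eq_neq tu => ->; rewrite mulr0 eq_sym oner_eq0.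
  have := p_cube ilt k; have := p_cube jlt k; rewrite mxE => /andP[j1 j2] /andP[i1 i2] /eqP.
  by move=> + [] -> h; apply; lra.
pose x : d.-tuple R := [tuple d%:R^-1 * \sum_(a < d.-1.+1) tnth (q a) k | k < d].
have dR : d%:R != 0 :> R by rewrite pnatr_eq0 -lt0n.
have d1R : 0 < d%:R^-1 :> R by rewrite invr_gt0 ltr0n.
have avgc (c1 : R) : d%:R^-1 * \sum_(a < d.-1.+1) c1 = c1.
  by rewrite sumr_const card_ord prednK // -[c1 *+ d]mulr_natl mulKf.
have bary p1 p2 : sqdist x p1 - sqdist x p2 =
    d%:R^-1 * \sum_(a < d.-1.+1) (sqdist (q a) p1 - sqdist (q a) p2).
  under [in RHS]eq_bigr do rewrite /sqdist -sumrB.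
  rewrite /sqdist -sumrB exchange_big mulr_sumr; apply: eq_bigr => k _ /=.
  rewrite (eq_bigr (fun a => (2 * (tnth p2 k - tnth p1 k)) * tnth (q a) k +
     (tnth p1 k ^+ 2 - tnth p2 k ^+ 2))); last by move=> a _; ring.
  by rewrite big_split /= mulrDr avgc -mulr_sumr tnth_mktuple; ring.
have neg (g : 'I_d.-1.+1 -> R) : (forall a, g a <= 0) -> ~ (forall a, g a = 0) ->
    d%:R^-1 * \sum_a g a < 0.
  move=> g0 gn; rewrite pmulr_rlt0 // lt_def sumr_le0 // andbT.
  apply/eqP => /esym/eqP; rewrite -oppr_eq0 -sumrN psumr_eq0; last by move=> a _; rewrite oppr_ge0.
  move=> /allP h; apply: gn => a; apply/eqP; rewrite -oppr_eq0.
  exact: h (mem_index_enum _).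
exists x; split.
- move=> k; rewrite tnth_mktuple; apply/andP; split.
    rewrite -subr_lt0 -{1}[-1]avgc -mulrBr -sumrB; apply: neg.
      by move=> a; have /andP[] := (qi a).1 k; lra.
    by move=> h; apply: (tight_k k (-1)) => [|a]; [ring | have := h a; lra].
  rewrite -subr_lt0 -{2}[1]avgc -mulrBr -sumrB; apply: neg.
    by move=> a; have /andP[] := (qi a).1 k; lra.
  by move=> h; apply: (tight_k k 1) => [|a]; [ring | have := h a; lra].
- by apply/eqP; rewrite -subr_eq0 bary big1 ?mulr0 // => a _; rewrite qij subrr.
- move=> l ln li lj; rewrite -subr_lt0 bary; apply: neg.
    by move=> a; rewrite subr_le0 (qi a).2.
  move=> h; case: (tight_l l ln) => [a|e|e]; last 2 first.
  + by rewrite e eqxx in li.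
  + by rewrite e eqxx in lj.
  by apply/eqP; rewrite -subr_eq0 h.
Qed.

End StrictFacets.

(** * Chains through strict facet points and their symmetries *)

Section StrictChains.
Context {R : realType} {d : nat}.
Implicit Types (x y : d.-tuple R) (p : nat -> d.-tuple R) (black : nat -> bool).

Definition strict_facet (n : nat) p (i j : nat) : Prop := exists x, strict_facet_point n p i j x.

(** Repetitions are allowed because [share_facet] may relate a cell to itself, while its description
    by strict facet points concerns distinct indices. [path_remove_repeats] drops them in the
    converse direction. *)
Definition strict_chain (n : nat) p black (k : 'I_d) : Prop :=
  exists i c (s : bool),
    [/\ all (fun j => (j < n)%N && black j) (i :: c),
        path (fun j l => `[< j = l \/ strict_facet n p j l >]) i c,
        near_center n p i `&` cube_face k s !=set0 &
        near_center n p (last i c) `&` cube_face k (~~ s) !=set0].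

Lemma all_path_sub (P : pred nat) (e e' : rel nat) i c :
  (forall j l, P j -> P l -> e j l -> e' j l) -> all P (i :: c) -> path e i c -> path e' i c.
Proof.
move=> ee'; elim: c i => //= l c IH i /and3P[Pi Pl Pc] /andP[il lc].
by rewrite ee' //= IH //= Pl.
Qed.

Lemma path_remove_repeats (P : pred nat) (e : rel nat) i c : all P (i :: c) ->
  path (fun j l => (j == l) || e j l) i c ->
  exists c', [/\ all P (i :: c'), path (fun j l => (j != l) && e j l) i c' & last i c' = last i c].
Proof.
elim: c i => [|l c IH] i /=; first by exists [::].
move=> /and3P[Pi Pl Pc] /andP[il lc].
have [|c' [/= /andP[_ Pc'] ec' lc']] := IH l _ lc; first by rewrite /= Pl.
have [e_il|nil] := eqVneq i l; first by exists c'; rewrite /= e_il Pl Pc'; split.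
exists (l :: c'); rewrite /= Pi Pl Pc' ec' nil; split => //.
by move: il; rewrite (negbTE nil) /= => ->.
Qed.

Lemma black_chain_strict (n : nat) p black (k : 'I_d) :
  (forall i j, (i < n)%N -> (j < n)%N -> p i = p j -> i = j) ->
  (forall i, (i < n)%N -> cube (p i)) ->
  black_chain_connects n p black k <-> strict_chain n p black k.
Proof.
move=> pinj pcube; have d0 : (0 < d)%N by exact: leq_ltn_trans (leq0n k) (ltn_ord k).
split=> -[i [c [s [call cpath ci cl]]]].
- exists i, c, s; rewrite -!voronoi_cellE; split => //; apply: all_path_sub call cpath.
  move=> j l /andP[jn _] /andP[ln _] /asboolP; rewrite !voronoi_cellE => jl; apply/asboolP.
  by have [->|njl] := eqVneq j l; [left | right; apply: share_strict_facet jl].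
- have cpath' : path (fun j l => (j == l) || `[< strict_facet n p j l >]) i c.
    apply: sub_path cpath => j l /asboolP[->|jl]; first by rewrite eqxx.
    by apply/orP; right; apply/asboolP.
  have [c' [call' path' last']] := path_remove_repeats call cpath'.
  exists i, c', s; rewrite last' !voronoi_cellE; split => //.
  apply: all_path_sub call' path' => j l /andP[jn _] /andP[ln _] /andP[jl /asboolP[x xjl]].
  by apply/asboolP; rewrite !voronoi_cellE; exact: strict_facet_share xjl.
Qed.

Lemma near_center_ext n p p' i : (forall j, (j < n)%N -> p j = p' j) -> (i < n)%N ->
  near_center n p i = near_center n p' i.
Proof.
move=> pp' ilt; apply/seteqP; split => x [cx xi]; split => // j jn.
  by rewrite -!pp' //; exact: xi.
by rewrite !pp' //; exact: xi.
Qed.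

Lemma strict_facet_ext n p p' i j : (forall j, (j < n)%N -> p j = p' j) ->
  (i < n)%N -> (j < n)%N -> strict_facet n p i j -> strict_facet n p' i j.
Proof.
move=> pp' ilt jlt [x [xi xij xl]]; exists x; split => //; first by rewrite -!pp'.
by move=> l ln li lj; rewrite -!pp' //; exact: xl.
Qed.

Lemma strict_chain_ext n p p' black black' k :
  (forall j, (j < n)%N -> p j = p' j) -> (forall j, (j < n)%N -> black j = black' j) ->
  strict_chain n p black k -> strict_chain n p' black' k.
Proof.
move=> pp' bb' [i [c [s [call cpath ci cl]]]]; exists i, c, s.
have ilt : (i < n)%N by move: call => /= /andP[/andP[]].
have llt : (last i c < n)%N by have /allP /(_ _ (mem_last i c)) /andP[] := call.
split.
- apply: sub_all call => j /andP[jn bj]; by rewrite jn -bb'.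
- apply: all_path_sub call cpath => j l /andP[jn _] /andP[ln _] /asboolP[->|jl]; apply/asboolP.
    by left.
  by right; exact: strict_facet_ext jl.
- by rewrite -(near_center_ext pp').
- by rewrite -(near_center_ext pp').
Qed.

Definition perm_coord (tau : 'S_d) x : d.-tuple R := [tuple tnth x (tau k) | k < d].

Lemma tnth_perm_coord tau x k : tnth (perm_coord tau x) k = tnth x (tau k).
Proof. by rewrite tnth_mktuple. Qed.

Lemma sqdist_perm tau x y : sqdist (perm_coord tau x) (perm_coord tau y) = sqdist x y.
Proof.
rewrite /sqdist [RHS](reindex_inj (@perm_inj _ tau)) /=.
by apply: eq_bigr => k _; rewrite !tnth_perm_coord.
Qed.

Lemma cube_perm tau x : cube x -> cube (perm_coord tau x).
Proof. by move=> cx k; rewrite tnth_perm_coord. Qed.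

Lemma perm_coordK tau : cancel (perm_coord tau) (perm_coord tau^-1%g).
Proof. by move=> x; apply: eq_from_tnth => k; rewrite !tnth_perm_coord permKV. Qed.

Lemma near_center_perm n p tau i x : near_center n p i x ->
  near_center n (perm_coord tau \o p) i (perm_coord tau x).
Proof.
move=> [cx xi]; split; first exact: cube_perm.
by move=> j jn; rewrite /= !sqdist_perm; exact: xi.
Qed.

(** A permutation of the coordinates is an isometry of the cube that carries the faces orthogonal to
    the axis [tau k] onto those orthogonal to [k]. *)
Lemma strict_chain_perm n p black (tau : 'S_d) (k : 'I_d) :
  strict_chain n p black (tau k) -> strict_chain n (perm_coord tau \o p) black k.
Proof.
move=> [i [c [s [call cpath ci cl]]]]; exists i, c, s.
have face j s' : near_center n p j `&` cube_face (tau k) s' !=set0 ->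
    near_center n (perm_coord tau \o p) j `&` cube_face k s' !=set0.
  move=> [x [xj [cx xk]]]; exists (perm_coord tau x); split; first exact: near_center_perm.
  by split; [exact: cube_perm | rewrite tnth_perm_coord].
split => //; [|exact: face|exact: face].
apply: sub_path cpath => j l /asboolP[->|[x [xi xjl xm]]]; apply/asboolP; [by left|right].
exists (perm_coord tau x); split => [m||m mn mj ml]; rewrite ?tnth_perm_coord //=.
  by rewrite !sqdist_perm.
by rewrite !sqdist_perm; exact: xm.
Qed.

Lemma strict_chain_relabel n p black k (s t : nat -> nat) :
  (forall j, (j < n)%N -> (s j < n)%N) -> (forall j, (j < n)%N -> (t j < n)%N) ->
  (forall j, (j < n)%N -> s (t j) = j) ->
  strict_chain n (p \o s) (black \o s) k -> strict_chain n p black k.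
Proof.
move=> sn tn st [i [c [b [call cpath ci cl]]]]; exists (s i), (map s c), b.
have near j x : near_center n (p \o s) j x -> near_center n p (s j) x.
  by move=> [cx xj]; split => // l ln; rewrite -(st l ln); apply: xj; exact: tn.
split.
- rewrite -map_cons all_map; apply: sub_all call => j /= /andP[jn ->].
  by rewrite sn.
- rewrite path_map; apply: sub_path cpath => j l /asboolP[->|[x [xi xjl xm]]]; apply/asboolP => /=.
    by left.
  right; exists x; split => // m mn mj ml; rewrite -(st m mn); apply: xm; first exact: tn.
    by apply: contra_neq mj => <-; rewrite st.
  by apply: contra_neq ml => <-; rewrite st.
- by have [x [xi xf]] := ci; exists x; split => //; exact: near.
- by have [x [xi xf]] := cl; exists x; split; [rewrite last_map; exact: near|].
Qed.

Lemma hex_strict n p (col : nat -> 'I_d) : (0 < n)%N ->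
  (forall i j, (i < n)%N -> (j < n)%N -> i != j -> touching n p i j -> strict_facet n p i j) ->
  exists k, strict_chain n p (fun j => col j == k) k.
Proof.
move=> n0 gen; have [k [i [c [call cpath ci cl]]]] := hex_touching p col n0.
exists k, i, c, true; split => //; apply: all_path_sub call cpath.
move=> j l /andP[jn _] /andP[ln _] /asboolP jl; apply/asboolP.
by have [->|njl] := eqVneq j l; [left | right; exact: gen].
Qed.

(* If the bisector of [p i] and [p j] meets the cell of [j] only at its boundary,
   then pulling [p i] towards [p j] makes it cross the interior. *)
Lemma touching_dilation n p p' (s : R) i j : (i < n)%N -> (j < n)%N -> i != j -> 1 < s ->
  (forall a b, (a < n)%N -> (b < n)%N -> p a = p b -> a = b) -> cube (p j) ->
  (forall l, l != i -> p' l = p l) ->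
  (forall k, tnth (p' i) k = tnth (p j) k + s * (tnth (p i) k - tnth (p j) k)) ->
  touching n p' i j -> strict_facet n p i j.
Proof.
move=> ilt jlt ij s1 pinj cpj p'l p'i [x' [[cx' x'i] [_ x'j]]].
have pneq l : (l < n)%N -> l != j -> p j <> p l.
  by move=> ln /eqP lj jl; apply: lj; apply: pinj.
(* For a center at [p j + t (p i - p j)] this difference is [t^2 W - 2 t S]. It vanishes at [t = 0]
   and, as [x'] is in both cells of [p'], at [t = s]; hence it is negative at [t = 1], in
   between. *)
have x'lt : sqdist x' (p i) - sqdist x' (p j) < 0.
  have W0 : 0 < sqdist (p i) (p j) by apply: sqdist_gt0 => e; apply: pneq ij _.
  have : sqdist x' (p' i) - sqdist x' (p j) = 0.
    by apply/eqP; rewrite subr_eq0 -(p'l j) 1?eq_sym // eq_le x'i // x'j.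
  pose S := \sum_k (tnth x' k - tnth (p j) k) * (tnth (p i) k - tnth (p j) k).
  have E t (q : d.-tuple R) : (forall k, tnth q k = tnth (p j) k + t * (tnth (p i) k - tnth (p j) k)) ->
     sqdist x' q - sqdist x' (p j) = t ^+ 2 * sqdist (p i) (p j) - 2 * t * S.
    move=> qE; rewrite /sqdist /S !mulr_sumr -!sumrB; apply: eq_bigr => k _; rewrite qE; ring.
  rewrite (E s _ p'i) (E 1 (p i)); last by move=> k; ring.
  clear E; move: (sqdist (p i) (p j)) W0 (S) => {S} W W0 S h.
  have /eqP : s * (s * W - 2 * S) = 0 by rewrite -h; ring.
  rewrite mulf_eq0 => /orP[/eqP s0|/eqP h']; first by lra.
  have : 0 < (s - 1) * W by rewrite mulr_gt0 // subr_gt0.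
  by rewrite mulrBl mul1r expr1n mul1r mulr1; lra.
(* Pulling [p j] slightly towards the origin yields [y], interior to the cube and to the cell [j] of
   [p]. *)
have [e /andP[e0 e1] eP] := @small_parameter R [seq (- sqdist (p j) (p l),
     sqdist [tuple 0 | _ < d] (p j) - sqdist [tuple 0 | _ < d] (p l) + sqdist (p j) (p l))
     | l : 'I_n <- enum 'I_n & (l != j :> nat)]
  ltac:(by move=> c /mapP[l]; rewrite mem_filter => /andP[lj _] -> /=; rewrite oppr_lt0; apply/sqdist_gt0/pneq).
pose y := mix e (p j) [tuple 0 | _ < d].
have yl l : (l < n)%N -> l != j -> sqdist y (p j) - sqdist y (p l) < 0.
  move=> ln lj; rewrite sqdist_mix sqdistxx.
  have := eP (- sqdist (p j) (p l),
     sqdist [tuple 0 | _ < d] (p j) - sqdist [tuple 0 | _ < d] (p l) + sqdist (p j) (p l)).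
  have h : (- sqdist (p j) (p l),
     sqdist [tuple 0 | _ < d] (p j) - sqdist [tuple 0 | _ < d] (p l) + sqdist (p j) (p l)) \in
     [seq (- sqdist (p j) (p l),
     sqdist [tuple 0 | _ < d] (p j) - sqdist [tuple 0 | _ < d] (p l) + sqdist (p j) (p l))
     | l : 'I_n <- enum 'I_n & (l != j :> nat)].
    by apply/mapP; exists (Ordinal ln) => //; rewrite mem_filter mem_enum /= lj.
  move=> /(_ h) /=; apply: le_lt_trans; rewrite le_eqVlt; apply/orP; left; apply/eqP; ring.
have ycube k : -1 < tnth y k < 1.
  rewrite tnth_mix tnth_mktuple mulr0 addr0; have /andP[h1 h2] := cpj k.
  by apply/andP; split; nra.
pose a := sqdist y (p i) - sqdist y (p j); pose b := sqdist x' (p i) - sqdist x' (p j).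
have a0 : 0 < a by have := yl i ilt ij; rewrite /a; lra.
have b0 : b < 0 by [].
have ab : 0 < a - b by lra.
(* The segment from [y] to [x'] crosses the bisector of [p i] and [p j] here. As [t < 1], the strict
   inequalities at [y] and the weak ones at [x'] combine into strict ones. *)
pose t := a / (a - b).
have t0 : 0 < t by rewrite divr_gt0.
have t1 : t < 1 by rewrite ltr_pdivrMr //; lra.
have tE : (1 - t) * a + t * b = 0.
  by rewrite /t; field; rewrite gt_eqF.
exists (mix t y x'); split.
- move=> k; rewrite tnth_mix; have /andP[h1 h2] := ycube k; have /andP[h3 h4] := cx' k.
  by apply/andP; split; nra.
- by apply/eqP; rewrite -subr_eq0 sqdist_mix -/a -/b tE.
move=> l ln li lj.
have -> : sqdist (mix t y x') (p i) = sqdist (mix t y x') (p j).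
  by apply/eqP; rewrite -subr_eq0 sqdist_mix -/a -/b tE.
rewrite -subr_lt0 sqdist_mix.
have := yl l ln lj; have : sqdist x' (p j) - sqdist x' (p l) <= 0.
  by rewrite subr_le0 -(p'l j) 1?eq_sym // -(p'l l) //; exact: x'j.
by move: (sqdist y _ - _) (sqdist x' _ - _) => A B; nra.
Qed.

End StrictChains.

(** * Measurability of chain events *)

Section MeasurablePredicates.
Context {R : realType} {disp : measure_display} {T : measurableType disp}.
Implicit Types (P Q : T -> Prop).

Lemma measurable_lt (f g : T -> R) : measurable_fun setT f -> measurable_fun setT g ->
  measurable [set t | f t < g t].
Proof.
move=> mf mg; have mt : measurable [set true] by [].
by have := measurable_fun_ltr mf mg measurableT mt; rewrite setTI.
Qed.

Lemma measurable_le (f g : T -> R) : measurable_fun setT f -> measurable_fun setT g ->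
  measurable [set t | f t <= g t].
Proof.
move=> mf mg; have mt : measurable [set true] by [].
by have := measurable_fun_ler mf mg measurableT mt; rewrite setTI.
Qed.

Lemma measurable_exists (I : countType) (P : I -> T -> Prop) :
  (forall i, measurable [set t | P i t]) -> measurable [set t | exists i, P i t].
Proof.
move=> mP; rewrite (_ : mkset _ = \bigcup_i [set t | P i t]).
  exact: countable_bigcupT_measurable.
by apply/seteqP; split => t [i]; exists i.
Qed.

Lemma measurable_forall (I : countType) (P : I -> T -> Prop) :
  (forall i, measurable [set t | P i t]) -> measurable [set t | forall i, P i t].
Proof.
move=> mP; rewrite -[X in measurable X]setCK; apply: measurableC.
rewrite (_ : ~` _ = [set t | exists i, ~ P i t]).
  apply: measurable_exists => i.
  by rewrite (_ : mkset _ = ~` [set t | P i t]) //; exact: measurableC.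
by apply/seteqP; split => t; rewrite /= -existsNE.
Qed.

Lemma measurable_conj P Q : measurable [set t | P t] -> measurable [set t | Q t] ->
  measurable [set t | P t /\ Q t].
Proof. by move=> mP mQ; exact: (measurableI _ _ mP mQ). Qed.

Lemma measurable_cstimpl (C : Prop) Q : (C -> measurable [set t | Q t]) ->
  measurable [set t | C -> Q t].
Proof.
move=> CQ; have [c|nc] := pselect C.
  by rewrite (_ : mkset _ = [set t | Q t]); [exact: CQ | apply/seteqP; split => t /=; tauto].
by rewrite (_ : mkset _ = setT); [exact: measurableT | apply/seteqP; split => t /=; tauto].
Qed.

Lemma measurable_cstand (C : Prop) Q : (C -> measurable [set t | Q t]) ->
  measurable [set t | C /\ Q t].
Proof.
move=> CQ; have [c|nc] := pselect C.
  by rewrite (_ : mkset _ = [set t | Q t]); [exact: CQ | apply/seteqP; split => t /=; tauto].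
by rewrite (_ : mkset _ = set0); [exact: measurable0 | apply/seteqP; split => t /=; tauto].
Qed.

Lemma measurable_ext P Q : (forall t, P t <-> Q t) -> measurable [set t | P t] ->
  measurable [set t | Q t].
Proof. by move=> PQ; rewrite (_ : mkset P = mkset Q) //; apply/seteqP; split => t /PQ. Qed.

End MeasurablePredicates.

Section CompactProjection.
Context {R : realType} {d : nat} {disp : measure_display} {T : measurableType disp}.

Definition rat_row (q : d.-tuple rat) : 'rV[R]_d := \row_k ratr (tnth q k).

Lemma rat_row_dense (y : 'rV[R]_d) (A : set 'rV[R]_d) :
  (forall k, -1 <= y 0 k <= 1) -> nbhs y A ->
  exists2 q, A (rat_row q) & forall k, -1 <= rat_row q 0 k <= 1.
Proof.
move=> y11 /nbhs_ballP[e /= e0 eA].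
have /choice[q qP] : forall k, exists q : rat, ball (y 0 k) e (ratr q : R) /\ -1 <= (ratr q : R) <= 1.
  move=> k; have /andP[y1 y2] := y11 k.
  have [yk|yk] := ltP (y 0 k) 1; last first.
    exists 1; rewrite rmorph1; split; last by rewrite lexx andbT; lra.
    have -> : y 0 k = 1 by apply/eqP; rewrite eq_le y2 yk.
    exact: ballxx.
  have [|q] := @rat_in_itvoo _ (y 0 k) (Num.min 1 (y 0 k + e)).
    by rewrite lt_min yk ltrDl.
  rewrite in_itv /= lt_min => /and3P[q1 q2 q3]; exists q; split; last by apply/andP; split; lra.
  by rewrite /ball /= ltr_norml; apply/andP; split; lra.
exists [tuple q k | k < d]; last by move=> k; rewrite mxE tnth_mktuple; exact: (qP k).2.
apply: eA; split => // i k; rewrite ord1 [X in ball _ _ X]mxE tnth_mktuple; exact: (qP k).1.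
Qed.

(** The quantifier over the uncountable cube is replaced by countable ones: for each [r], some
    rational point satisfies the constraints up to [1 / r.+1]. Density gives one direction, a
    cluster point of the approximate solutions the other. *)
Lemma measurable_compact_exists (I : finType) (g : I -> 'rV[R]_d -> T -> R) :
  (forall i t, continuous (fun y => g i y t)) ->
  (forall i y, measurable_fun setT (g i y)) ->
  measurable [set t | exists2 y : 'rV[R]_d, (forall k, -1 <= y 0 k <= 1) &
    forall i, g i y t <= 0].
Proof.
move=> cg mg.
apply: (@measurable_ext _ _ (fun t => forall r : nat, exists q : d.-tuple rat,
   (forall k, -1 <= (rat_row q : 'rV[R]_d) 0 k <= 1) /\
   forall i, g i (rat_row q) t < r.+1%:R^-1)); last first.
  apply: measurable_forall => r; apply: measurable_exists => q.
  apply: measurable_cstand => _; apply: measurable_forall => i.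
  by apply: measurable_lt => //; exact: mg.
move=> t; split => [h|[y y11 ys] r]; last first.
  have nA : nbhs y [set z | forall i, g i z t < r.+1%:R^-1].
    apply: (@filter_forall _ _ (fun i => [set z | g i z t < r.+1%:R^-1]) (nbhs y)) => i.
    have yi : g i y t < r.+1%:R^-1 by rewrite (le_lt_trans (ys i)) // invr_gt0.
    exact: (cg i t y _ (lt_nbhsl yi)).
  have [q qA q11] := rat_row_dense y11 nA.
  by exists q; split => // i; exact: qA.
have /choice[q qP] := h.
have [|x [x11 xcl]] := @cube_cluster R d (fun r => rat_row (q r)); first by move=> r; exact: (qP r).1.
exists x => // i; rewrite leNgt; apply/negP => gx.
have gx2 : g i x t / 2 < g i x t by rewrite ltr_pdivrMr // mulr_natr mulr2n ltrDl.
have nA : nbhs x [set z | g i x t / 2 < g i z t] := cg i t x _ (lt_nbhsr gx2).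
have [M _ MP] := near_infty_natSinv_lt (PosNum (divr_gt0 gx (ltr0n R 2))).
have [r Mr] := xcl _ nA M; rewrite /= => gr.
have := (qP r).2 i; have : r.+1%:R^-1 < g i x t / 2 := MP _ Mr.
by move: _^-1 => c; lra.
Qed.

End CompactProjection.

Section Configurations.
Context {R : realType} {d n : nat}.
Local Notation config := (n.-tuple (d.-tuple R)).
Implicit Types (t : config) (x y : d.-tuple R).

Definition cfg t (i : nat) : d.-tuple R := nth [tuple 0 | _ < d] t i.

Lemma cfgE t (i : 'I_n) : cfg t i = tnth t i.
Proof. by rewrite /cfg (tnth_nth [tuple 0 | _ < d]). Qed.

Lemma measurable_cfg i : measurable_fun setT (fun t => cfg t i).
Proof.
have [ilt|nlt] := ltnP i n.
  rewrite (_ : (fun t => cfg t i) = (fun t => tnth t (Ordinal ilt))); first exact: measurable_tnth.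
  by apply/funext => t; rewrite -cfgE.
rewrite (_ : (fun t => cfg t i) = cst [tuple 0 | _ < d]); first exact: measurable_cst.
by apply/funext => t; rewrite /cfg nth_default // size_tuple.
Qed.

Lemma measurable_cfg_coord i (k : 'I_d) : measurable_fun setT (fun t => tnth (cfg t i) k).
Proof.
apply: (measurableT_comp (f := fun x : d.-tuple R => tnth x k)); first exact: measurable_tnth.
exact: measurable_cfg.
Qed.

Lemma measurable_sqdist_cfg y i : measurable_fun setT (fun t => sqdist y (cfg t i)).
Proof.
apply: measurable_sum => k; apply: measurable_funX; apply: measurable_funB => //.
exact: measurable_cfg_coord.
Qed.

Lemma measurable_sqdist_cfg2 i j : measurable_fun setT (fun t => sqdist (cfg t i) (cfg t j)).
Proof.
by apply: measurable_sum => k; apply: measurable_funX; apply: measurable_funB => //;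
  exact: measurable_cfg_coord.
Qed.

Definition good_cfg : set config :=
  [set t | (forall i : 'I_n, cube (cfg t i)) /\
           (forall i j : 'I_n, i != j -> cfg t i <> cfg t j)].

Lemma measurable_good_cfg : measurable good_cfg.
Proof.
apply: measurable_conj.
  apply: measurable_forall => i; apply: measurable_forall => k.
  apply: (@measurable_ext _ _ (fun t => -1 <= tnth (cfg t i) k /\ tnth (cfg t i) k <= 1)).
    by move=> t; split=> [[-> ->]|/andP].
  by apply: measurable_conj; apply: measurable_le => //; exact: measurable_cfg_coord.
apply: measurable_forall => i; apply: measurable_forall => j; apply: measurable_cstimpl => _.
apply: (@measurable_ext _ _ (fun t => 0 < sqdist (cfg t i) (cfg t j))).
  move=> t; split => [h e|]; first by rewrite e sqdistxx ltxx in h.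
  exact: sqdist_gt0.
by apply: measurable_lt => //; exact: measurable_sqdist_cfg2.
Qed.

Lemma good_cfg_inj t : good_cfg t ->
  forall i j, (i < n)%N -> (j < n)%N -> cfg t i = cfg t j -> i = j.
Proof.
move=> [_ ti] i j ilt jlt e; apply/eqP; apply: contraT => ij.
by have := ti (Ordinal ilt) (Ordinal jlt) ij e.
Qed.

Lemma good_cfg_cube t : good_cfg t -> forall i, (i < n)%N -> cube (cfg t i).
Proof. by move=> [tc _] i ilt; exact: (tc (Ordinal ilt)). Qed.

(** A facet need not contain a rational point, so it is detected from its two sides: [q] is strictly
    on the side of [i], and both [i] and [j] beat all other centers there. Only strict inequalities
    occur. *)
Definition ambient_facet_side (i j : nat) (q : d.-tuple rat) t : Prop :=
  [/\ (forall k, -1 < (rat_row q : 'rV[R]_d) 0 k < 1),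
   (forall l : 'I_n, l != i :> nat -> l != j :> nat ->
     sqdist (row_tuple (rat_row q)) (cfg t i) < sqdist (row_tuple (rat_row q)) (cfg t l) /\
     sqdist (row_tuple (rat_row q)) (cfg t j) < sqdist (row_tuple (rat_row q)) (cfg t l)) &
   sqdist (row_tuple (rat_row q)) (cfg t i) < sqdist (row_tuple (rat_row q)) (cfg t j)].

Lemma nbhs_ltr (f g : 'rV[R]_d -> R) (x : 'rV[R]_d) : continuous f -> continuous g -> f x < g x ->
  nbhs x [set z | f z < g z].
Proof.
move=> cf cg fg.
have c : continuous (fun z => g z - f z) by move=> z; apply: continuousB; [exact: cg | exact: cf].
have fg0 : 0 < g x - f x by rewrite subr_gt0.
have h : nbhs x [set z | 0 < g z - f z] := c x _ (lt_nbhsr fg0).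
by apply: filterS h => z /=; rewrite subr_gt0.
Qed.

(** A small step from [x] towards the center [i] lands on its side and keeps the other strict
    inequalities; a nearby rational point does as well. *)
Lemma facet_side_exists t i j x : good_cfg t -> (i < n)%N -> (j < n)%N -> i != j ->
  strict_facet_point n (cfg t) i j x -> exists q, ambient_facet_side i j q t.
Proof.
move=> gt ilt jlt ij [xint xij xl].
pose D (a b : nat) := (sqdist x (cfg t a) - sqdist x (cfg t b),
   (sqdist (cfg t i) (cfg t a) - sqdist (cfg t i) (cfg t b)) - (sqdist x (cfg t a) - sqdist x (cfg t b))).
pose s := [seq D i l | l : 'I_n <- enum 'I_n & (l != i :> nat) && (l != j :> nat)] ++
          [seq D j l | l : 'I_n <- enum 'I_n & (l != i :> nat) && (l != j :> nat)].
have [|e /andP[e0 e1] eP] := @small_parameter R s.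
  move=> c; rewrite mem_cat => /orP[] /mapP[l]; rewrite mem_filter => /andP[/andP[li lj] _] -> /=.
    by rewrite subr_lt0 xl.
  by rewrite subr_lt0 -xij xl.
pose y := mix e x (cfg t i).
pose v : 'rV[R]_d := \row_k tnth y k.
have vy : row_tuple v = y by apply: eq_from_tnth => k; rewrite tnth_row mxE.
have yint k : -1 < v 0 k < 1.
  rewrite mxE tnth_mix; have /andP[h1 h2] := xint k; have /andP[h3 h4] := good_cfg_cube gt ilt k.
  by apply/andP; split; nra.
have ys (a b : nat) : D a b \in s -> sqdist y (cfg t a) < sqdist y (cfg t b).
  move=> /eP /= h; rewrite -subr_lt0 sqdist_mix; apply: le_lt_trans h.
  by rewrite le_eqVlt; apply/orP; left; apply/eqP; ring.
have yij : sqdist y (cfg t i) < sqdist y (cfg t j).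
  rewrite -subr_lt0 sqdist_mix xij subrr mulr0 add0r sqdistxx sub0r mulrN oppr_lt0 mulr_gt0 //.
  by apply: sqdist_gt0 => ee; move/negP: ij; apply; apply/eqP; exact: (good_cfg_inj gt).
have nA : nbhs v [set z : 'rV[R]_d | [/\ (forall k, -1 < z 0 k /\ z 0 k < 1),
   (forall l : 'I_n, l != i :> nat -> l != j :> nat ->
     sqdist (row_tuple z) (cfg t i) < sqdist (row_tuple z) (cfg t l) /\
     sqdist (row_tuple z) (cfg t j) < sqdist (row_tuple z) (cfg t l)) &
   sqdist (row_tuple z) (cfg t i) < sqdist (row_tuple z) (cfg t j)]].
  have n1 : nbhs v [set z : 'rV[R]_d | forall k, -1 < z 0 k /\ z 0 k < 1].
    apply: (@filter_forall _ _ (fun k : 'I_d => [set z : 'rV[R]_d | -1 < z 0 k /\ z 0 k < 1]) (nbhs v)) => k.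
    have /andP[h1 h2] := yint k.
    apply: filterI.
      apply: (@nbhs_ltr (fun _ => -1) (fun z => z 0 k)) => //.
        exact: cst_continuous.
      exact: coord_continuous.
    apply: (@nbhs_ltr (fun z => z 0 k) (fun _ => 1)) => //.
      exact: coord_continuous.
    exact: cst_continuous.
  have n2 (a b : nat) : sqdist y (cfg t a) < sqdist y (cfg t b) ->
      nbhs v [set z : 'rV[R]_d | sqdist (row_tuple z) (cfg t a) < sqdist (row_tuple z) (cfg t b)].
    by move=> h; apply: nbhs_ltr; rewrite ?vy //; exact: continuous_sqdist.
  have n3 : nbhs v [set z : 'rV[R]_d | forall l : 'I_n, l != i :> nat -> l != j :> nat ->
     sqdist (row_tuple z) (cfg t i) < sqdist (row_tuple z) (cfg t l) /\
     sqdist (row_tuple z) (cfg t j) < sqdist (row_tuple z) (cfg t l)].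
    apply: (@filter_forall _ _ (fun l : 'I_n => [set z : 'rV[R]_d | l != i :> nat -> l != j :> nat ->
     sqdist (row_tuple z) (cfg t i) < sqdist (row_tuple z) (cfg t l) /\
     sqdist (row_tuple z) (cfg t j) < sqdist (row_tuple z) (cfg t l)]) (nbhs v)) => l.
    have [/andP[li lj]|nl] := boolP ((l != i :> nat) && (l != j :> nat)); last first.
      by apply: nearW => z li lj; rewrite li lj in nl.
    have Dl a : a = i \/ a = j -> D a l \in s.
      by move=> [] ->; rewrite mem_cat; apply/orP; [left|right];
        apply/mapP; exists l => //; rewrite mem_filter mem_enum li lj.
    have h := @filterI _ (nbhs v) (nbhs_filter v) _ _ (n2 i l (ys i l (Dl i (or_introl erefl)))) (n2 j l (ys j l (Dl j (or_intror erefl)))).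
    refine (@filterS _ (nbhs v) (nbhs_filter v) _ _ _ h). by move=> z [].
  have h := @filterI _ (nbhs v) (nbhs_filter v) _ _ (@filterI _ (nbhs v) (nbhs_filter v) _ _ n1 n3) (n2 i j yij).
  by apply: (@filterS _ (nbhs v) (nbhs_filter v) _ _ _ h) => z [[h1 h3] h2].
have [|q [q1 q2 q3] _] := rat_row_dense _ nA.
  by move=> k; have /andP[/ltW -> /ltW ->] := yint k.
by exists q; split => // k; have [-> ->] := q1 k.
Qed.

Lemma strict_facet_point_sym p i j x :
  strict_facet_point n p i j x -> strict_facet_point n p j i x.
Proof. by move=> [xi xij xl]; split => // l ln lj li; rewrite -xij; exact: xl. Qed.

(** Conversely, the segment between witnesses on the two sides crosses the bisector, and by
    convexity the strict inequalities hold at the crossing. *)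
Lemma strict_facet_sides t (i j : nat) : good_cfg t -> (i < n)%N -> (j < n)%N -> i != j ->
  strict_facet n (cfg t) i j <->
  exists q r, ambient_facet_side i j q t /\ ambient_facet_side j i r t.
Proof.
move=> gt ilt jlt ij; split=> [[x xij]|[q [r [[qi ql qij] [ri rl rij]]]]].
  have [q qP] := facet_side_exists gt ilt jlt ij xij.
  have [|r rP] := facet_side_exists gt jlt ilt _ (strict_facet_point_sym xij); first by rewrite eq_sym.
  by exists q, r.
set y := row_tuple (rat_row q) in ql qij; set z := row_tuple (rat_row r) in rl rij.
pose a := sqdist y (cfg t i) - sqdist y (cfg t j).
pose b := sqdist z (cfg t i) - sqdist z (cfg t j).
have a0 : a < 0 by rewrite subr_lt0.
have b0 : 0 < b by rewrite subr_gt0.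
pose e := a / (a - b).
have ab : a - b < 0 by lra.
have e0 : 0 < e by rewrite /e -mulrNN -invrN divr_gt0 ?oppr_gt0.
have e1 : e < 1.
  by rewrite /e -mulrNN -invrN ltr_pdivrMr ?oppr_gt0 //; lra.
have eE : (1 - e) * a + e * b = 0 by rewrite /e; field; rewrite lt_eqF.
exists (mix e y z); split.
- move=> k; rewrite tnth_mix !tnth_row; have /andP[h1 h2] := qi k; have /andP[h3 h4] := ri k.
  by apply/andP; split; nra.
- by apply/eqP; rewrite -subr_eq0 sqdist_mix -/a -/b eE.
- move=> l ln li lj; rewrite -subr_lt0 sqdist_mix.
  have [h1 _] := ql (Ordinal ln) li lj; have [_ h2] := rl (Ordinal ln) lj li.
  move: h1 h2; rewrite -subr_lt0 -[X in _ -> is_true X -> _]subr_lt0 /=.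
  by move: (sqdist y _ - _) (sqdist z _ - _) => A B h1 h2; nra.
Qed.

Lemma measurable_strict_facet (i j : nat) : (i < n)%N -> (j < n)%N -> i != j ->
  measurable [set t | good_cfg t /\ strict_facet n (cfg t) i j].
Proof.
move=> ilt jlt ij.
apply: (@measurable_ext _ _ (fun t => good_cfg t /\
   exists q r, ambient_facet_side i j q t /\ ambient_facet_side j i r t)).
  by move=> t; split=> -[gt] => /(strict_facet_sides gt ilt jlt ij).
apply: measurable_conj; first exact: measurable_good_cfg.
have side a b q : measurable [set t | ambient_facet_side a b q t].
  apply: (@measurable_ext _ _ (fun t => (forall k, -1 < (rat_row q : 'rV[R]_d) 0 k < 1) /\
   ((forall l : 'I_n, l != a :> nat -> l != b :> nat ->
     sqdist (row_tuple (rat_row q)) (cfg t a) < sqdist (row_tuple (rat_row q)) (cfg t l) /\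
     sqdist (row_tuple (rat_row q)) (cfg t b) < sqdist (row_tuple (rat_row q)) (cfg t l)) /\
   sqdist (row_tuple (rat_row q)) (cfg t a) < sqdist (row_tuple (rat_row q)) (cfg t b)))).
    by move=> t; split=> [[? []]|[]].
  apply: measurable_cstand => _; apply: measurable_conj.
    apply: measurable_forall => l; do 2!apply: measurable_cstimpl => _.
    by apply: measurable_conj; apply: measurable_lt; exact: measurable_sqdist_cfg.
  by apply: measurable_lt; exact: measurable_sqdist_cfg.
by apply: measurable_exists => q; apply: measurable_exists => r; apply: measurable_conj.
Qed.

End Configurations.

Section ConfigurationEvents.
Context {R : realType} {d n : nat}.
Local Notation config := (n.-tuple (d.-tuple R)).
Implicit Types (t : config) (x y : d.-tuple R).

Lemma continuous_sqdist_sub p q : continuous (fun v : 'rV[R]_d => sqdist (row_tuple v) p - sqdist (row_tuple v) q).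
Proof. by move=> u; apply: continuousB; exact: continuous_sqdist. Qed.

Lemma continuous_affine_coord (a : R) (k : 'I_d) :
  continuous (fun v : 'rV[R]_d => 1 - a * v 0 k).
Proof.
move=> v; apply: (@continuousB _ _ _ (fun _ => 1 : R) (fun y : 'rV[R]_d => a * y 0 k)).
  exact: cst_continuous.
by apply: (@continuousM _ _ (fun _ => a) (fun y : 'rV[R]_d => y 0 k));
  [exact: cst_continuous | exact: coord_continuous].
Qed.

Lemma measurable_touch_face (i : nat) (k : 'I_d) (s : bool) :
  measurable [set t : config | near_center n (cfg t) i `&` cube_face k s !=set0].
Proof.
(* Within the cube, the inequality attached to [None] forces the equation of the face. *)
pose g (o : option 'I_n) (y : 'rV[R]_d) (t : config) : R :=
  if o is Some l then sqdist (row_tuple y) (cfg t i) - sqdist (row_tuple y) (cfg t l)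
  else 1 - (-1) ^+ s * y 0 k.
apply: (@measurable_ext _ _ (fun t : config => exists2 y : 'rV[R]_d,
   (forall k, -1 <= y 0 k <= 1) & forall o, g o y t <= 0)).
  move=> t; split=> [[y y11 yg]|[x [[cx xi] [_ xk]]]].
    exists (row_tuple y).
    have cy : cube (row_tuple y) by move=> l; rewrite tnth_row.
    split; split => //.
      by move=> j jn; have := yg (Some (Ordinal jn)); rewrite /= subr_le0.
    have := yg None; rewrite /= tnth_row; have /andP[h1 h2] := y11 k.
    move: (y 0 k) h1 h2 => z h1 h2.
    by case: (s) => /=; rewrite ?expr1 ?expr0 => h; apply: le_anti; apply/andP; split; lra.
  exists (\row_k tnth x k); first by move=> l; rewrite mxE.
  have xE : row_tuple (\row_k tnth x k) = x by apply: eq_from_tnth => l; rewrite tnth_row mxE.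
  move=> [l|] /=; first by rewrite xE subr_le0; exact: xi.
  by rewrite mxE xk -expr2 -exprM mulnC exprM sqrrN !expr1n subrr.
apply: measurable_compact_exists => [[l|] t|[l|] y] /=.
- exact: continuous_sqdist_sub.
- exact: continuous_affine_coord.
- by apply: measurable_funB; exact: measurable_sqdist_cfg.
- exact: measurable_cst.
Qed.

Lemma measurable_touching (i j : nat) : measurable [set t : config | touching n (cfg t) i j].
Proof.
pose g (o : bool * 'I_n) (y : 'rV[R]_d) (t : config) : R :=
  sqdist (row_tuple y) (cfg t (if o.1 then i else j)) - sqdist (row_tuple y) (cfg t o.2).
apply: (@measurable_ext _ _ (fun t : config => exists2 y : 'rV[R]_d,
   (forall k, -1 <= y 0 k <= 1) & forall o, g o y t <= 0)).
  move=> t; split=> [[y y11 yg]|[x [[cx xi] [_ xj]]]].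
    exists (row_tuple y).
    have cy : cube (row_tuple y) by move=> l; rewrite tnth_row.
    split; split => // l ln.
      by have := yg (true, Ordinal ln); rewrite subr_le0.
    by have := yg (false, Ordinal ln); rewrite subr_le0.
  exists (\row_k tnth x k); first by move=> l; rewrite mxE.
  have xE : row_tuple (\row_k tnth x k) = x by apply: eq_from_tnth => l; rewrite tnth_row mxE.
  by move=> [[] l]; rewrite /g /= xE subr_le0; [exact: xi | exact: xj].
apply: measurable_compact_exists => [w t | w y].
- exact: continuous_sqdist_sub.
- by apply: measurable_funB; exact: measurable_sqdist_cfg.
Qed.

Definition chain_cfg (black : nat -> bool) (k : 'I_d) : set config :=
  [set t : config | good_cfg t /\ strict_chain n (cfg t) black k].

(** There are countably many candidate chains of indices; for a fixed one, each link and both end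
    conditions are measurable. *)
Lemma measurable_chain_cfg black k : measurable (chain_cfg black k).
Proof.
apply: (@measurable_ext _ _ (fun t : config => exists (i : nat) (c : seq nat) (s : bool),
   all (fun j => (j < n)%N && black j) (i :: c) /\
   ((good_cfg t /\ path (fun j l => `[< j = l \/ strict_facet n (cfg t) j l >]) i c) /\
   (near_center n (cfg t) i `&` cube_face k s !=set0 /\
    near_center n (cfg t) (last i c) `&` cube_face k (~~ s) !=set0)))).
  move=> t; split=> [[i [c [s [h1 [[gt h2] [h3 h4]]]]]]|[gt [i [c [s [h1 h2 h3 h4]]]]]].
    by split => //; exists i, c, s.
  by exists i, c, s.
apply: measurable_exists => i; apply: measurable_exists => c; apply: measurable_exists => s.
apply: measurable_cstand => call.
apply: measurable_conj; last by apply: measurable_conj; exact: measurable_touch_face.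
elim: c i call => [|l c IH] i /=.
  move=> _; apply: (@measurable_ext _ _ good_cfg); last exact: measurable_good_cfg.
  by move=> t; split=> [gt|[]].
move=> /and3P[/andP[ilt _] /andP[llt bl] call].
apply: (@measurable_ext _ _ (fun t : config => (good_cfg t /\ (i = l \/ strict_facet n (cfg t) i l)) /\
   (good_cfg t /\ path (fun j l => `[< j = l \/ strict_facet n (cfg t) j l >]) l c))).
  move=> t; split=> [[[gt il] [_ ->]]|[gt /andP[/asboolP il lc]]]; last by split.
  by split => //; rewrite andbT; apply/asboolP.
apply: measurable_conj; last by apply: IH; rewrite /= llt bl.
have [->|il] := eqVneq i l.
  apply: (@measurable_ext _ _ good_cfg); last exact: measurable_good_cfg.
  by move=> t; split=> [gt|[]] //; split => //; left.
apply: (@measurable_ext _ _ (fun t : config => good_cfg t /\ strict_facet n (cfg t) i l)).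
  move=> t; split=> [[gt h]|[gt [e|h]]]; [by split; [|right] | by rewrite e eqxx in il | by split].
exact: measurable_strict_facet.
Qed.

Definition degenerate_cfg (i j : 'I_n) : set config :=
  [set t : config | good_cfg t /\ touching n (cfg t) i j /\ ~ strict_facet n (cfg t) i j].

Lemma measurable_degenerate_cfg (i j : 'I_n) : i != j -> measurable (degenerate_cfg i j).
Proof.
move=> ij.
have -> : degenerate_cfg i j = (good_cfg `&` [set t : config | touching n (cfg t) i j]) `\`
   [set t : config | good_cfg t /\ strict_facet n (cfg t) i j].
  apply/seteqP; split => t; first by move=> [gt [tij sij]]; split => // -[].
  by move=> [[gt tij] sij]; split => //; split => // h; apply: sij.
apply: measurableD; last exact: measurable_strict_facet.
by apply: measurableI; [exact: measurable_good_cfg | exact: measurable_touching].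
Qed.

Lemma hex_cfg t (col : 'I_n -> 'I_d) : (0 < n)%N -> good_cfg t ->
  (forall i j, i != j -> ~ degenerate_cfg i j t) ->
  exists k, chain_cfg (fun j => oapp (fun l => col l == k) false (insub j)) k t.
Proof.
move=> n0 gt nd.
have [|k [i [c [s [call cpath ci cl]]]]] :=
    @hex_strict R d n (cfg t) (fun j => col (insubd (Ordinal n0) j)) n0.
  move=> i j ilt jlt ij tij; apply: contrapT => nij.
  by apply: (nd (Ordinal ilt) (Ordinal jlt)).
exists k; split => //; exists i, c, s; split => //.
apply: sub_all call => j /andP[jn /eqP <-]; rewrite jn insubT /=.
by rewrite /insubd insubT.
Qed.

Definition perm_cfg (tau : 'S_d) t : config := [tuple of map (perm_coord tau) t].

Lemma cfg_perm tau t i : (i < n)%N -> cfg (perm_cfg tau t) i = perm_coord tau (cfg t i).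
Proof.
move=> ilt; rewrite /cfg /= (nth_map [tuple 0 | _ < d]) ?size_tuple //.
Qed.

Lemma good_cfg_perm tau t : good_cfg t -> good_cfg (perm_cfg tau t).
Proof.
move=> [tc ti]; split => [i|i j ij]; rewrite !cfg_perm //; first exact: cube_perm.
by move/(can_inj (perm_coordK tau)); exact: ti.
Qed.

Lemma chain_cfg_perm (tau : 'S_d) black (k : 'I_d) t :
  chain_cfg black (tau k) t -> chain_cfg black k (perm_cfg tau t).
Proof.
move=> [gt st]; split; first exact: good_cfg_perm.
by apply: strict_chain_ext (strict_chain_perm st) => // j jn; rewrite cfg_perm.
Qed.

Definition relabel_cfg (s : 'S_n) t : config := [tuple tnth t (s i) | i < n].

Lemma cfg_relabel (s : 'S_n) t (i : 'I_n) : cfg (relabel_cfg s t) i = cfg t (s i).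
Proof. by rewrite !cfgE tnth_mktuple. Qed.

Lemma good_cfg_relabel s t : good_cfg t -> good_cfg (relabel_cfg s t).
Proof.
move=> [tc ti]; split => [i|i j ij]; rewrite !cfg_relabel //.
by apply: ti; rewrite (inj_eq perm_inj).
Qed.

Definition color_fun (b : {ffun 'I_n -> bool}) (j : nat) : bool :=
  oapp b false (insub j).

Lemma color_funE b (i : 'I_n) : color_fun b i = b i.
Proof. by rewrite /color_fun valK. Qed.

Lemma relabel_cfgK s : cancel (relabel_cfg s) (relabel_cfg s^-1%g).
Proof. by move=> t; apply: eq_from_tnth => i; rewrite !tnth_mktuple permKV. Qed.

Lemma chain_cfg_relabel (s : 'S_n) (b : {ffun 'I_n -> bool}) k t :
  chain_cfg (color_fun [ffun i => b (s i)]) k (relabel_cfg s t) -> chain_cfg (color_fun b) k t.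
Proof.
move=> [gt st]; split.
  by rewrite -(relabel_cfgK s t); exact: good_cfg_relabel.
pose f (u : 'S_n) (j : nat) : nat := oapp (fun l => u l : nat) j (insub j).
have fE u (l : 'I_n) : f u l = u l by rewrite /f valK.
have flt u j : (j < n)%N -> (f u j < n)%N by move=> jn; rewrite (fE u (Ordinal jn)).
apply: (@strict_chain_relabel _ _ n (cfg t) _ k (f s) (f s^-1%g)).
- exact: flt.
- exact: flt.
- move=> j jn; have := fE s (s^-1%g (Ordinal jn)).
  by rewrite -(fE s^-1%g (Ordinal jn)) permKV.
apply: strict_chain_ext st => j jn.
  by have := cfg_relabel s t (Ordinal jn); rewrite /= => ->; rewrite (fE s (Ordinal jn)).
by rewrite (color_funE _ (Ordinal jn)) ffunE /= (fE s (Ordinal jn)) color_funE.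
Qed.

End ConfigurationEvents.

(** * Powers of a measure *)

Section MeasureStructures.
Context {R : realType}.
Local Open Scope ereal_scope.

(** An alias of [mu] carrying the proof as a parameter, so that the sigma-finite structure can be
    inferred from the term. [image_measure] carries a measurability proof for the same reason. *)
Definition sigma_finite_of (disp : measure_display) (T : measurableType disp)
  (mu : {measure set T -> \bar R}) (_ : sigma_finite setT mu) : set T -> \bar R := mu.

Section SigmaFinite.
Context (disp : measure_display) (T : measurableType disp).
Variables (mu : {measure set T -> \bar R}) (mu_sf : sigma_finite setT mu).

HB.instance Definition _ := Measure.on (sigma_finite_of mu_sf).
HB.instance Definition _ := Measure_isSigmaFinite.Build _ _ _ (sigma_finite_of mu_sf) mu_sf.

End SigmaFinite.

Definition image_measure (d1 d2 : measure_display) (T1 : measurableType d1) (T2 : measurableType d2)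
  (mu : {measure set T1 -> \bar R}) (f : T1 -> T2) (_ : measurable_fun setT f) : set T2 -> \bar R :=
  fun A => mu (f @^-1` A).

Section ImageMeasure.
Context (d1 d2 : measure_display) (T1 : measurableType d1) (T2 : measurableType d2).
Variables (mu : {measure set T1 -> \bar R}) (f : T1 -> T2) (mf : measurable_fun setT f).

Let image0 : image_measure mu mf set0 = 0.
Proof. exact: measure0. Qed.

Let image_ge0 A : 0 <= image_measure mu mf A.
Proof. exact: measure_ge0. Qed.

Let image_additive : semi_sigma_additive (image_measure mu mf).
Proof. exact: (@measure_semi_sigma_additive _ _ _ (pushforward mu f)). Qed.

HB.instance Definition _ := isMeasure.Build _ _ _ (image_measure mu mf)
  image0 image_ge0 image_additive.

End ImageMeasure.
End MeasureStructures.

Section TuplePower.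
Context {R : realType} {disp : measure_display} {T : measurableType disp}.
Local Open Scope ereal_scope.

Lemma behead_cons_tuple (n : nat) (x : T) (t : n.-tuple T) :
  [tuple of behead [tuple of x :: t]] = t :> n.-tuple T.
Proof. exact: val_inj. Qed.

Lemma measurable_tuple_cons (n : nat) :
  measurable_fun [set: T * n.-tuple T] (fun p => [tuple of p.1 :: p.2]).
Proof. exact: measurable_cons. Qed.

Definition tuple_box (n : nat) (A : 'I_n -> set T) : set (n.-tuple T) :=
  [set t | forall i, A i (tnth t i)].

Lemma measurable_tuple_box n (A : 'I_n -> set T) : (forall i, measurable (A i)) ->
  measurable (tuple_box A).
Proof.
move=> mA; rewrite (_ : tuple_box A = \bigcap_(i in [set: 'I_n]) ((fun t : n.-tuple T => tnth t i) @^-1` A i)).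
  apply: fin_bigcap_measurable => // i _; rewrite -[X in measurable X]setTI.
  exact: measurable_tnth.
by apply/seteqP; split => t At i; [move=> _|]; exact: At.
Qed.

Lemma tuple_boxI n (A B : 'I_n -> set T) :
  tuple_box A `&` tuple_box B = tuple_box (fun i => A i `&` B i).
Proof.
apply/seteqP; split => t; first by move=> [At Bt] i; split.
by move=> ABt; split => i; have [] := ABt i.
Qed.

(** Boxes form a generating family stable under intersection, and the powers of [F] exhaust the
    space by sets of finite measure. *)
Lemma tuple_measure_unique (n : nat) (F : (set T)^nat)
    (m1 m2 : {measure set (n.-tuple T) -> \bar R}) :
  (forall k, measurable (F k)) -> nondecreasing_seq F -> \bigcup_k F k = setT ->
  (forall k, m1 (tuple_box (fun _ : 'I_n => F k)) < +oo) ->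
  (forall A : 'I_n -> set T, (forall i, measurable (A i)) -> m1 (tuple_box A) = m2 (tuple_box A)) ->
  forall B, measurable B -> m1 B = m2 B.
Proof.
move=> mF ndF FT m1F m12.
pose G : set (set (n.-tuple T)) := [set B | exists A : 'I_n -> set T, (forall i, measurable (A i)) /\ B = tuple_box A].
apply: (measure_unique G (fun k => tuple_box (fun _ : 'I_n => F k))) => //.
- apply/seteqP; split; last first.
    apply: smallest_sub; first exact: sigma_algebra_measurable.
    by move=> _ [A [mA ->]]; exact: measurable_tuple_box.
  apply: smallest_sub; first exact: smallest_sigma_algebra.
  move=> B; rewrite -bigcup_seq /= => -[i _ [A mA <-]]; apply: sub_sigma_algebra.
  exists (fun j => if j == i then A else setT); split; first by move=> j; case: ifP.
  rewrite setTI; apply/seteqP; split => t /=.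
    by move=> At j; case: eqP => // ->.
  by move=> /(_ i); rewrite eqxx.
- move=> _ _ [A [mA ->]] [B [mB ->]]; exists (fun i => A i `&` B i); split.
    by move=> i; exact: measurableI.
  exact: tuple_boxI.
- by move=> k; exists (fun _ => F k).
- apply/seteqP; split => // t _.
  have /choice[k kP] : forall i, exists k, F k (tnth t i).
    by move=> i; have : setT (tnth t i) by []; rewrite -FT => -[k _ Fk]; exists k.
  exists (\max_(i < n) k i)%N => // i.
  by have /subsetPset := ndF _ _ (leq_bigmax (F := k) i); apply; exact: kP.
- by move=> _ [A [mA ->]]; exact: m12.
Qed.

Variable m : {sigma_finite_measure set T -> \bar R}.

(** The recursion of [volume] for an arbitrary measure. It is used twice: with Lebesgue measure for
    the volume, and with the volume on the cube for configurations of centers. *)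
Fixpoint tuple_power (n : nat) : set (n.-tuple T) -> \bar R :=
  match n with
  | 0 => fun A => \d_([tuple] : 0.-tuple T) A
  | n'.+1 => fun A => \int[m]_x tuple_power [set t : n'.-tuple T | A [tuple of x :: t]]
  end.

(** The iterated integral is the image of a product measure under [cons]. Sigma-finiteness goes
    through the induction because the next product requires it. *)
Lemma tuple_power_measure n : exists M : {sigma_finite_measure set (n.-tuple T) -> \bar R},
  forall A, M A = tuple_power A.
Proof.
elim: n => [|n [M ME]].
  have h : sigma_finite setT (\d_([tuple] : 0.-tuple T) : {measure set (0.-tuple T) -> \bar R}).
    exact: sigma_finiteT.
  by exists (sigma_finite_of h).
pose I := image_measure (m \x M) (measurable_tuple_cons (n := n)).
have h : sigma_finite setT I.
  have /sigma_finiteP[F [FT ndF Foo]] := sigma_finiteT m.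
  have /sigma_finiteP[G [GT ndG Goo]] := sigma_finiteT M.
  exists (fun k => [set t : n.+1.-tuple T | F k (thead t) /\ G k [tuple of behead t]]).
    apply/seteqP; split => // t _.
    have : setT (thead t) by []; rewrite FT => -[k1 _ Fk1].
    have : setT [tuple of behead t] by []; rewrite GT => -[k2 _ Gk2].
    exists (maxn k1 k2) => //; split.
      by have /subsetPset := ndF _ _ (leq_maxl k1 k2); exact.
    by have /subsetPset := ndG _ _ (leq_maxr k1 k2); exact.
  move=> k; have [mFk Fk] := Foo k; have [mGk Gk] := Goo k; split.
    apply: measurableI; rewrite -[X in measurable X]setTI.
      exact: measurable_tnth.
    exact: measurable_behead.
  rewrite /I /image_measure (_ : _ @^-1` _ = F k `*` G k); last first.
    by apply/seteqP; split => -[x t] /=; rewrite theadE behead_cons_tuple.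
  by rewrite [ltLHS]product_measure1E // lte_mul_pinfty // ge0_fin_numE.
exists (sigma_finite_of h) => A /=; apply: eq_integral => x _ /=.
rewrite -ME; congr (M _); apply/seteqP; split => t; rewrite /xsection /= in_setE; exact.
Qed.

Definition tuple_power_meas n : {sigma_finite_measure set (n.-tuple T) -> \bar R} :=
  projT1 (cid (tuple_power_measure n)).

Lemma tuple_power_measE n A : tuple_power_meas n A = tuple_power A.
Proof. by rewrite /tuple_power_meas; case: cid. Qed.

Lemma tuple_power_box n (A : 'I_n -> set T) : (forall i, measurable (A i)) ->
  tuple_power (tuple_box A) = \prod_(i < n) m (A i).
Proof.
elim: n A => [|n IH] A mA /=.
  by rewrite big_ord0 diracE mem_set // => -[].
rewrite big_ord_recl -(IH (fun i => A (lift ord0 i))); last by move=> i; exact: mA.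
rewrite -tuple_power_measE.
rewrite (eq_integral (fun x => (\1_(A ord0) x)%:E *
   tuple_power_meas n (tuple_box (fun i => A (lift ord0 i))))); last first.
  move=> x _; rewrite indicE -tuple_power_measE.
  have [xA|xA] := boolP (x \in A ord0); rewrite /= ?mul1e ?mul0e.
    congr (tuple_power_meas n _); apply/seteqP; split => t At i.
      by have := At (lift ord0 i); rewrite tnthS.
    case: (unliftP ord0 i) => [j ->|->]; first by rewrite tnthS.
    by rewrite tnth0; exact/set_mem.
  rewrite -[RHS](measure0 (tuple_power_meas n)); congr (tuple_power_meas n _).
  apply/seteqP; split => // t /(_ ord0); rewrite tnth0 => Ax.
  by move: xA; rewrite mem_set.
rewrite ge0_integralZr ?integral_indic ?setIT //.
by apply: measurableT_comp.
Qed.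

Lemma tuple_power_unique n (m2 : {measure set (n.-tuple T) -> \bar R}) :
  (forall A : 'I_n -> set T, (forall i, measurable (A i)) ->
     m2 (tuple_box A) = \prod_(i < n) m (A i)) ->
  forall B, measurable B -> m2 B = tuple_power B.
Proof.
move=> m2A B mB; have /sigma_finiteP[F [FT ndF Foo]] := sigma_finiteT m.
rewrite -tuple_power_measE; apply/esym.
apply: (@tuple_measure_unique n F) => // [k|k|A mA]; first exact: (Foo k).1.
  rewrite [ltLHS]tuple_power_measE tuple_power_box; last by move=> _; exact: (Foo k).1.
  have : m (F k) \is a fin_num by rewrite ge0_fin_numE //; exact: (Foo k).2.
  by move=> /fineK <-; rewrite prodEFin ltry.
by rewrite [LHS]tuple_power_measE tuple_power_box // m2A.
Qed.

Definition perm_tuple n (s : 'S_n) (t : n.-tuple T) : n.-tuple T := [tuple tnth t (s i) | i < n].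

Lemma measurable_perm_tuple n (s : 'S_n) : measurable_fun setT (perm_tuple s).
Proof.
apply/measurable_fun_tnthP => i /=.
rewrite (_ : _ \o _ = fun t => tnth t (s i)); first exact: measurable_tnth.
by apply/funext => t /=; rewrite tnth_mktuple.
Qed.

Lemma tuple_power_perm n (s : 'S_n) (B : set (n.-tuple T)) : measurable B ->
  tuple_power (perm_tuple s @^-1` B) = tuple_power B.
Proof.
move=> mB; rewrite -[LHS]tuple_power_measE.
apply: (@tuple_power_unique n (image_measure (tuple_power_meas n) (measurable_perm_tuple s))) => // A mA.
rewrite /= /image_measure (_ : _ @^-1` _ = tuple_box (fun i => A (s^-1%g i))).
  rewrite [LHS]tuple_power_measE tuple_power_box // [RHS](reindex_inj (@perm_inj _ s^-1%g)) //.
apply/seteqP; split => t tA i.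
  by have := tA (s^-1%g i); rewrite tnth_mktuple permKV.
by have := tA (s i); rewrite permK tnth_mktuple.
Qed.

(** Serves for dilations of the space, coordinate by coordinate, and with [c = 1] for an isometry
    applied to all the centers. *)
Lemma tuple_power_scale n (phi : 'I_n -> T -> T) (c : {nonneg R}) (B : set (n.-tuple T)) :
  (forall i, measurable_fun setT (phi i)) ->
  (forall i A, measurable A -> m (phi i @^-1` A) = c%:num%:E * m A) -> measurable B ->
  tuple_power [set t | B [tuple phi i (tnth t i) | i < n]] = (c%:num ^+ n)%:E * tuple_power B.
Proof.
move=> mphi mA mB; pose f t : n.-tuple T := [tuple phi i (tnth t i) | i < n].
have mf : measurable_fun setT f.
  apply/measurable_fun_tnthP => i.
  rewrite (_ : _ \o _ = phi i \o (fun t => tnth t i)).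
    by apply: measurableT_comp => //; exact: measurable_tnth.
  by apply/funext => t /=; rewrite tnth_mktuple.
have /sigma_finiteP[F [FT ndF Foo]] := sigma_finiteT m.
have c0 : (0 <= c%:num ^+ n)%R by rewrite exprn_ge0.
pose m1 := mscale (NngNum c0) (tuple_power_meas n).
have m1E A : m1 A = (c%:num ^+ n)%:E * tuple_power A by rewrite /m1 /mscale /= tuple_power_measE.
rewrite -m1E -[LHS]tuple_power_measE.
apply/esym; apply: (@tuple_measure_unique n F m1 (image_measure (tuple_power_meas n) mf)) => //.
- by move=> k; exact: (Foo k).1.
- move=> k; rewrite [ltLHS]m1E tuple_power_box; last by move=> _; exact: (Foo k).1.
  have : m (F k) \is a fin_num by rewrite ge0_fin_numE //; exact: (Foo k).2.
  by move=> /fineK <-; rewrite prodEFin -EFinM ltry.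
- move=> A mA'; rewrite [LHS]m1E tuple_power_box //= /image_measure.
  rewrite (_ : _ @^-1` _ = tuple_box (fun i => phi i @^-1` A i)).
    rewrite [RHS]tuple_power_measE tuple_power_box; last first.
      by move=> i; rewrite -[X in measurable X]setTI; exact: mphi.
    under [in RHS]eq_bigr do rewrite mA //.
    by rewrite big_split /= prodEFin prodr_const card_ord.
  by apply/seteqP; split => t tA i; have := tA i; rewrite /= tnth_mktuple.
Qed.

(** The definition integrates over the head last; uniqueness of the product measure exchanges the
    order. *)
Lemma tuple_power_null_head n (B : set (n.+1.-tuple T)) : measurable B ->
  (forall t : n.-tuple T, m [set x | B [tuple of x :: t]] = 0) -> tuple_power B = 0.
Proof.
move=> mB B0; set M := tuple_power_meas n.
have mB' : measurable ((fun p : T * n.-tuple T => [tuple of p.1 :: p.2]) @^-1` B).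
  by rewrite -[X in measurable X]setTI; exact: measurable_tuple_cons.
transitivity ((m \x M) ((fun p : T * n.-tuple T => [tuple of p.1 :: p.2]) @^-1` B)).
  apply: eq_integral => x _; rewrite -[LHS]tuple_power_measE; congr (M _).
  by apply/seteqP; split => t; rewrite /xsection /= in_setE; exact.
rewrite (@product_measure_unique _ _ _ _ _ m M (m \x^ M)) //; last first.
  by move=> A1 A2 mA1 mA2; rewrite [LHS]product_measure2E.
apply: integral0_eq => t _ /=; rewrite -[RHS](B0 t); congr (m _).
by apply/seteqP; split => x; rewrite /ysection /= in_setE; exact.
Qed.

Lemma tuple_power_null_section n (B : set (n.-tuple T)) (i : 'I_n) : measurable B ->
  (forall t : n.-tuple T, m [set x | B [tuple if j == i then x else tnth t j | j < n]] = 0) ->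
  tuple_power B = 0.
Proof.
case: n B i => [|n] B i mB B0; first by have := ltn_ord i.
rewrite -(tuple_power_perm (tperm i ord0)) //.
apply: tuple_power_null_head => [|t].
  by rewrite -[X in measurable X]setTI; exact: measurable_perm_tuple.
(* The entry [point] is a dummy: it lands at position [i], where [x] overwrites it. *)
have e (x : T) : perm_tuple (tperm i ord0) [tuple of x :: t] = [tuple if j == i then x
    else tnth (perm_tuple (tperm i ord0) [tuple of point :: t]) j | j < n.+1].
  apply: eq_from_tnth => j; rewrite !tnth_mktuple.
  have [->|ji] := eqVneq j i; first by rewrite tpermL tnth0.
  have : tperm i ord0 j != ord0 by rewrite -(inj_eq (@perm_inj _ (tperm i ord0))) tpermK tpermR.
  by case: (unliftP ord0 (tperm i ord0 j)) => [l ->|->]; rewrite ?eqxx // !tnthS.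
rewrite -[RHS](B0 (perm_tuple (tperm i ord0) [tuple of point :: t])); congr (m _).
by apply/seteqP; split => x /=; rewrite -e.
Qed.

End TuplePower.

(** * Volume *)

Section Volume.
Context {R : realType}.
Local Open Scope ereal_scope.

Lemma volumeE d (A : set (d.-tuple R)) : volume A = tuple_power lebesgue_measure A.
Proof.
elim: d A => [//|d IH] A /=; apply: eq_integral => x _; exact: IH.
Qed.

Lemma lebesgue_dilation (q s : R) (A : set (measurableTypeR R)) : (0 < s)%R -> measurable A ->
  lebesgue_measure ((fun x : R => (q + s * (x - q))%R) @^-1` A) = (s^-1)%:E * lebesgue_measure A.
Proof.
move=> s0 mA.
have mf : measurable_fun setT (fun x : measurableTypeR R => (q + s * (x - q))%R : measurableTypeR R).
  by apply: measurable_funD => //; apply: measurable_funM => //; apply: measurable_funB.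
have s0' : (0 <= s)%R by exact: ltW.
pose mu := mscale (NngNum s0') (image_measure lebesgue_measure mf).
have -> : lebesgue_measure A = mu A.
  apply: lebesgue_measure_unique => // _ [[a b] _ <-].
  transitivity (s%:E * lebesgue_measure ((fun x : R => (q + s * (x - q))%R) @^-1` `]a, b]%classic)); last by [].
  rewrite (_ : _ @^-1` _ = `](q + (a - q) / s)%R, (q + (b - q) / s)%R]%classic).
    rewrite !lebesgue_measure_itv /= !lte_fin ltrD2l ltr_pM2r ?invr_gt0 // ltrD2r.
    case: ifP => // _; last by rewrite mule0.
    rewrite -!EFinB -EFinM; congr EFin; field.
    by rewrite gt_eqF.
  apply/seteqP; split => x /=; rewrite !in_itv /=.
    move=> /andP[ax xb]; rewrite -ltrBrDl -lerBlDl ltr_pdivrMr // ler_pdivlMr //.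
    by apply/andP; split; nra.
  move=> /andP[]; rewrite -ltrBrDl -lerBlDl ltr_pdivrMr // ler_pdivlMr // => ax xb.
  by apply/andP; split; nra.
rewrite [mu A](_ : _ = s%:E * lebesgue_measure ((fun x : R => (q + s * (x - q))%R) @^-1` A)) //.
by rewrite muleA -EFinM mulVf ?mul1e // gt_eqF.
Qed.

Definition dilate d (q : d.-tuple R) (s : R) (x : d.-tuple R) : d.-tuple R :=
  [tuple (tnth q k + s * (tnth x k - tnth q k))%R | k < d].

Lemma volume_dilation d (q : d.-tuple R) (s : R) (A : set (d.-tuple R)) :
  (0 < s)%R -> measurable A ->
  volume (dilate q s @^-1` A) = ((s^-1) ^+ d)%:E * volume A.
Proof.
move=> s0 mA; have s1 : (0 <= s^-1)%R by rewrite invr_ge0 ltW.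
rewrite !volumeE.
apply: (@tuple_power_scale _ _ _ lebesgue_measure d
  (fun k x => (tnth q k + s * (x - tnth q k))%R) (NngNum s1) A) => //.
- by move=> i; apply: measurable_funD => //; apply: measurable_funM => //; apply: measurable_funB.
- by move=> i B mB; exact: lebesgue_dilation.
Qed.

Lemma cubeE d : @cube R d = tuple_box (T := measurableTypeR R) (fun _ => `[(-1 : R)%R, (1 : R)%R]%classic).
Proof. by apply/seteqP; split => x cx k; have := cx k; rewrite /= in_itv. Qed.

Lemma measurable_cube d : measurable (@cube R d).
Proof. by rewrite cubeE; apply: measurable_tuple_box. Qed.

Lemma volume_cube d : volume (@cube R d) = ((2 : R) ^+ d)%:E.
Proof.
rewrite volumeE cubeE tuple_power_box //.
rewrite (eq_bigr (fun=> (2 : R)%:E)) => [|i _]; first by rewrite prodEFin prodr_const card_ord.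
rewrite [LHS]lebesgue_measure_itv /= lte_fin ifT; last by lra.
by rewrite -EFinB; congr EFin; lra.
Qed.

(* [R] and [measurableTypeR R] have the same measurable sets, but different displays. *)
Lemma measurable_tuple_id d :
  measurable_fun setT (id : d.-tuple (measurableTypeR R) -> d.-tuple R).
Proof. by move=> _ A mA; rewrite setTI; exact: mA. Qed.

Definition volume_measure d : {measure set (d.-tuple R) -> \bar R} :=
  image_measure (@tuple_power_meas R _ (measurableTypeR R) (@lebesgue_measure R) d)
    (@measurable_tuple_id d).

Lemma volume_measureE d A : volume_measure d A = volume A.
Proof. by rewrite volumeE -tuple_power_measE. Qed.

Lemma volume_perm d (tau : 'S_d) (A : set (d.-tuple R)) : measurable A ->
  volume (perm_coord tau @^-1` A) = volume A.
Proof. by move=> mA; rewrite !volumeE; exact: tuple_power_perm. Qed.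

Lemma measurable_dilate d (q : d.-tuple R) s : measurable_fun setT (dilate q s).
Proof.
apply/measurable_fun_tnthP => k.
rewrite (_ : _ \o _ = fun x : d.-tuple R => (tnth q k + s * (tnth x k - tnth q k))%R); last first.
  by apply/funext => x /=; rewrite tnth_mktuple.
apply: measurable_funD => //; apply: measurable_funM => //; apply: measurable_funB => //.
exact: measurable_tnth.
Qed.

(* The preimages of [B] under the dilations about [q] of ratios in (1, 2] are disjoint,
   lie in the cube, and each has volume at least 2^-d times that of [B]. *)
Lemma volume_radial0 d (q : d.-tuple R) (B : set (d.-tuple R)) : measurable B ->
  B `<=` @cube R d -> cube q ->
  (forall x s, (1 < s)%R -> B x -> ~ B (dilate q s x)) -> volume B = 0.
Proof.
move=> mB Bcube cq radial.
pose s (r : nat) : R := (1 + r.+1%:R^-1)%R.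
have s1 r : (1 < s r)%R by rewrite /s ltrDl invr_gt0.
have s2 r : (s r <= 2)%R.
  by rewrite /s -[2%R]/(1 + 1)%R lerD2l invf_le1 // ler1n.
have s0 r : (0 < s r)%R by apply: lt_trans (s1 r).
pose F r := dilate q (s r) @^-1` B.
have mF r : measurable (F r) by rewrite -[X in measurable X]setTI; exact: measurable_dilate.
have dil a b x : dilate q a (dilate q b x) = dilate q (a * b) x.
  by apply: eq_from_tnth => k; rewrite !tnth_mktuple; ring.
have tF : trivIset setT F.
  (* A common point would give a point of [B] whose dilate by [s b / s a > 1] is again in [B]. *)
  have lt_disj a b x : (s a < s b)%R -> F a x -> F b x -> False.
    move=> ab Fa Fb; apply: (radial (dilate q (s a) x) (s b / s a)%R) => //.
      by rewrite ltr_pdivlMr // mul1r.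
    by rewrite dil divfK ?gt_eqF.
  apply/trivIsetP => a b _ _ ab; apply/seteqP; split => // x [Fa Fb].
  have [sab|sba|sab] := ltgtP (s a) (s b).
  - exact: (lt_disj a b x).
  - exact: (lt_disj b a x).
  - case/negP: ab; move/addrI: sab => /invr_inj /eqP; rewrite eqr_nat eqSS; exact.
(* [x] lies between [q] and its dilate, as the ratio is at least 1. *)
have Fcube r : F r `<=` @cube R d.
  move=> x /Bcube cx k; have := cx k; rewrite tnth_mktuple; have := cq k.
  have := s1 r; move: (s r) (tnth q k) (tnth x k) => c a b c1 /andP[a1 a2] /andP[h1 h2].
  by apply/andP; split; nra.
have Fin A : A `<=` @cube R d -> measurable A -> volume A \is a fin_num.
  move=> Ac mA; rewrite -volume_measureE ge0_fin_numE //.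
  have Ale : volume_measure d A <= volume_measure d (@cube R d).
    exact: (le_measure _ (mem_set mA) (mem_set (@measurable_cube d)) Ac).
  by rewrite (le_lt_trans Ale) // volume_measureE volume_cube ltry.
have vB : volume B = (fine (volume B))%:E by rewrite fineK // Fin.
set v := fine (volume B) in vB.
have v0 : (0 <= v)%R by rewrite -lee_fin -vB -volume_measureE.
have Fge r : ((2^-1 ^+ d * v)%:E <= volume (F r))%E.
  rewrite volume_dilation // vB -EFinM lee_fin ler_wpM2r //.
  by apply: lerXn2r; rewrite ?nnegrE ?invr_ge0 ?lef_pV2 ?posrE // ltW.
have bound (M : nat) : (M%:R * (2^-1 ^+ d * v) <= 2 ^+ d)%R.
  rewrite -lee_fin -volume_cube.
  apply: (@le_trans _ _ (volume_measure d (\big[setU/set0]_(r < M) F r))).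
    rewrite measure_bigsetU //.
    apply: (@le_trans _ _ (\sum_(r < M) (2^-1 ^+ d * v)%:E)).
      by rewrite sumEFin sumr_const card_ord mulr_natl.
    by apply: lee_sum => r _; rewrite [leRHS]volume_measureE.
  have mU : measurable (\big[setU/set0]_(r < M) F r) by apply: bigsetU_measurable => r _; exact: mF.
  have Usub : \big[setU/set0]_(r < M) F r `<=` @cube R d.
    by rewrite -bigcup_mkord => x [r _ /Fcube].
  rewrite -volume_measureE.
  exact: (le_measure _ (mem_set mU) (mem_set (@measurable_cube d)) Usub).
rewrite vB; congr EFin; apply/eqP; rewrite eq_le v0 andbT leNgt; apply/negP => vpos.
have c0 : (0 < 2^-1 ^+ d * v)%R by rewrite mulr_gt0 // exprn_gt0.
have := bound (Num.bound (2 ^+ d / (2^-1 ^+ d * v))).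
rewrite -ler_pdivlMr // leNgt archi_boundP //.
by rewrite divr_ge0 ?exprn_ge0 // ltW.
Qed.

End Volume.

(** * The measure on configurations, and its null degenerate part *)

Section CubeMeasure.
Context {R : realType} {d : nat}.
Local Open Scope ereal_scope.

Definition volume_in_cube : {measure set (d.-tuple R) -> \bar R} :=
  mrestr (volume_measure d) (@measurable_cube R d).

Lemma volume_in_cubeE A : volume_in_cube A = volume (A `&` @cube R d).
Proof. by rewrite /volume_in_cube /= /mrestr volume_measureE. Qed.

Lemma volume_in_cube_sigma_finite : sigma_finite setT volume_in_cube.
Proof.
exists (fun _ => setT); first by apply/seteqP; split => // x _; exists 0%N.
move=> _; split; first exact: measurableT.
by rewrite volume_in_cubeE setTI volume_cube ltry.
Qed.

Definition cube_measure := sigma_finite_of volume_in_cube_sigma_finite.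

Lemma cube_measureE A : cube_measure A = volume (A `&` @cube R d).
Proof. exact: volume_in_cubeE. Qed.

Definition cfg_measure (n : nat) : {sigma_finite_measure set (n.-tuple (d.-tuple R)) -> \bar R} :=
  tuple_power_meas cube_measure n.

Lemma cfg_measureE n A : cfg_measure n A = tuple_power cube_measure A.
Proof. exact: tuple_power_measE. Qed.

Lemma measurable_perm_coord (tau : 'S_d) : measurable_fun setT (@perm_coord R d tau).
Proof.
apply/measurable_fun_tnthP => i.
rewrite (_ : _ \o _ = fun x : d.-tuple R => tnth x (tau i)); first exact: measurable_tnth.
by apply/funext => x /=; rewrite tnth_mktuple.
Qed.

Lemma cfg_measure_perm n (tau : 'S_d) (B : set (n.-tuple (d.-tuple R))) : measurable B ->
  cfg_measure n (perm_cfg tau @^-1` B) = cfg_measure n B.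
Proof.
move=> mB; rewrite !cfg_measureE.
have := @tuple_power_scale R _ _ cube_measure n (fun _ => perm_coord tau) (NngNum ler01) B.
rewrite /= expr1n mul1e => <- //.
- congr tuple_power; apply/seteqP; split => t /=; congr (B _); apply: eq_from_tnth => i;
    by rewrite tnth_mktuple tnth_map.
- by move=> _; exact: measurable_perm_coord.
- move=> _ A mA; rewrite mul1e [LHS]cube_measureE [RHS]cube_measureE -(@volume_perm _ _ tau (A `&` @cube R d)).
    congr volume; apply/seteqP; split => x [Ax cx]; split => //; first exact: cube_perm.
    by rewrite -(perm_coordK tau x); exact: cube_perm.
  by apply: measurableI => //; exact: (@measurable_cube R d).
Qed.

(** All centers but [i] are fixed. If a position [x] of [i] and its dilate about center [j] by a
    ratio [s > 1] were both degenerate, the contact at the dilate would produce a strict facet at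
    [x] by [touching_dilation]. So [volume_radial0] applies to each section. *)
Lemma cfg_measure_degenerate n (i j : 'I_n) : i != j ->
  cfg_measure n (degenerate_cfg i j) = 0.
Proof.
move=> ij; rewrite cfg_measureE.
apply: (@tuple_power_null_section _ _ _ cube_measure n _ i); first exact: measurable_degenerate_cfg.
move=> t; set S := [set x | _].
pose u x : n.-tuple (d.-tuple R) := [tuple if l == i then x else tnth t l | l < n].
have mu : measurable_fun setT u.
  apply/measurable_fun_tnthP => l; have [li|li] := eqVneq l i.
    rewrite (_ : _ \o _ = id); first exact: measurable_id.
    by apply/funext => x /=; rewrite tnth_mktuple li eqxx.
  rewrite (_ : _ \o _ = cst (tnth t l)); first exact: measurable_cst.
  by apply/funext => x /=; rewrite tnth_mktuple (negbTE li).
have mS : measurable S.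
  by rewrite -[X in measurable X]setTI; exact: (mu measurableT _ (measurable_degenerate_cfg ij)).
have uj x : cfg (u x) j = tnth t j by rewrite cfgE tnth_mktuple eq_sym (negbTE ij).
have ui x : cfg (u x) i = x by rewrite cfgE tnth_mktuple eqxx.
rewrite [LHS]cube_measureE.
have [cq|ncq] := pselect (cube (tnth t j)); last first.
  rewrite (_ : _ `&` _ = set0); first by rewrite -volume_measureE measure0.
  by apply/seteqP; split => // x [[[+ _] _] _] => /(_ j); rewrite uj => /ncq.
apply: (@volume_radial0 _ _ (tnth t j)) => //.
- by apply: measurableI => //; exact: (@measurable_cube R d).
- move=> x s s1 [[gx [_ nx]] _] [[_ [ty _]] _]; apply: nx.
  apply: (@touching_dilation R d n (cfg (u x)) (cfg (u (dilate (tnth t j) s x))) s i j) => //.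
  + exact: good_cfg_inj.
  + by rewrite uj.
  + move=> l li; have [ln|nl] := ltnP l n; last by rewrite /cfg !nth_default ?size_tuple.
    have e y : cfg (u y) l = tnth t (Ordinal ln).
      by rewrite -[l]/(nat_of_ord (Ordinal ln)) cfgE tnth_mktuple ifN //; exact: li.
    by rewrite !e.
  + by move=> k; rewrite ui tnth_mktuple uj ui.
Qed.

End CubeMeasure.

(** * The law of the centers *)

Section MeasureLemmas.
Context {R : realType} {disp : measure_display} {T : measurableType disp}.
Local Open Scope ereal_scope.

Lemma measure_eq_cover (m1 m2 : {measure set T -> \bar R}) (I : countType) (F : I -> set T) :
  (forall k, measurable (F k)) ->
  (forall k B, measurable B -> m1 (B `&` F k) = m2 (B `&` F k)) ->
  forall B, measurable B -> B `<=` \bigcup_k F k -> m1 B = m2 B.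
Proof.
move=> mF m12 B mB BF.
pose G (k : nat) : set T := oapp F set0 (unpickle k).
have mG k : measurable (G k) by rewrite /G; case: unpickle => [i|] /=; [exact: mF | exact: measurable0].
have mD k : measurable (seqDU G k).
  by apply: measurableD => //; apply: bigsetU_measurable => i _; exact: mG.
have BE : B = \bigcup_k (B `&` seqDU G k).
  rewrite -setI_bigcupr -seqDU_bigcup_eq setIidl // => x /BF[i _ Fi].
  by exists (pickle i) => //; rewrite /G pickleK.
have tD : trivIset setT (fun k => B `&` seqDU G k).
  by apply: trivIset_setIl; exact: trivIset_seqDU.
have mBD k : measurable (B `&` seqDU G k) by exact: measurableI.
rewrite BE !measure_semi_bigcup -?BE //; apply: eq_eseriesr => k _.
have e : B `&` seqDU G k = (B `&` seqDU G k) `&` G k.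
  by rewrite [RHS]setIidl // => x [_ []].
rewrite e /G; case: unpickle => [i|] /=; first exact: m12.
by rewrite setI0 !measure0.
Qed.

Lemma measure_bigcup_finType (mu : {measure set T -> \bar R}) (I : finType) (F : I -> set T) :
  (forall i, measurable (F i)) -> (forall i j, i != j -> F i `&` F j = set0) ->
  mu (\bigcup_i F i) = \sum_(i : I) mu (F i).
Proof.
move=> mF tF.
have -> : \sum_(i : I) mu (F i) = \sum_(i < #|{: I}|) mu (F (enum_val i)).
  by rewrite (reindex _ (onW_bij _ (enum_val_bij I))).
rewrite -(measure_bigsetU_ord mu xpredT (F := fun i : 'I_#|{: I}| => F (enum_val i))) //.
  congr (mu _); rewrite -bigcup_seq; apply/seteqP; split => x [i _ Fi].
    by exists (enum_rank i); rewrite ?enum_rankK //= mem_index_enum.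
  by exists (enum_val i).
by apply/trivIsetP => i j _ _ ij; apply: tF; apply: contra_neq ij => /enum_val_inj.
Qed.

End MeasureLemmas.

Section SeparatingBoxes.
Context {R : realType} {d n : nat}.
Local Notation config := (n.-tuple (d.-tuple R)).
Local Notation index := (n.-tuple (d.-tuple rat) * nat)%type.

Definition rat_box (w : index) (i : 'I_n) : set (d.-tuple R) :=
  [set x | forall k, `|tnth x k - ratr (tnth (tnth w.1 i) k)| < w.2.+1%:R^-1].

Definition disjoint_family (A : 'I_n -> set (d.-tuple R)) : Prop :=
  forall i j, i != j -> A i `&` A j = set0.

(** Countably many products of pairwise disjoint sets that cover the good configurations. Indices
    whose boxes overlap are sent to the empty set, which keeps the index type countable and
    plain. *)
Definition separating_box (w : index) : set config :=
  if `[< disjoint_family (rat_box w) >] then tuple_box (rat_box w) else set0.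

Lemma measurable_rat_box w i : measurable (rat_box w i).
Proof.
apply: measurable_forall => k; apply: measurable_lt => //.
apply: measurableT_comp => //; apply: measurable_funB => //; exact: measurable_tnth.
Qed.

Lemma measurable_separating_box w : measurable (separating_box w).
Proof.
rewrite /separating_box; case: asboolP => _; last exact: measurable0.
by apply: measurable_tuple_box => i; exact: measurable_rat_box.
Qed.

Lemma separating_box_cover (t : config) : good_cfg t -> exists w, separating_box w t.
Proof.
move=> [_ td].
(* The factor 4: a point common to the boxes [i] and [j] would join the two centers through both box
   centers in four steps, each shorter than [1 / m.+1] in every coordinate. *)
have /choice[M MP] : forall ij : 'I_n * 'I_n, exists M : nat, ij.1 != ij.2 ->
   exists k, 4 * M.+1%:R^-1 <= `|tnth (tnth t ij.1) k - tnth (tnth t ij.2) k|.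
  move=> [i j] /=; have [->|ij] := eqVneq i j; first by exists 0%N.
  have [k tk] : exists k, tnth (tnth t i) k != tnth (tnth t j) k.
    apply: contrapT => /forallNP h; apply: (td _ _ ij); rewrite !cfgE.
    by apply: eq_from_tnth => k; apply/eqP; have /negP := h k; rewrite negbK.
  pose e := `|tnth (tnth t i) k - tnth (tnth t j) k|.
  have e0 : 0 < e by rewrite normr_gt0 subr_eq0.
  have [M _ MP] := near_infty_natSinv_lt (PosNum (divr_gt0 e0 (ltr0n R 4))).
  exists M => _; exists k; have : M.+1%:R^-1 < e / 4 := MP M (leqnn M).
  by rewrite -/e; move: _^-1 => c; lra.
pose m := (\max_ij M ij)%N.
have mP i j : i != j -> exists k, 4 * m.+1%:R^-1 <= `|tnth (tnth t i) k - tnth (tnth t j) k|.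
  move=> ij; have [k] := MP (i, j) ij; exists k; apply: le_trans p.
  by rewrite ler_pM2l // lef_pV2 ?posrE // ler_nat ltnS (leq_bigmax (i, j)).
have m0 : 0 < m.+1%:R^-1 :> R by rewrite invr_gt0.
have /choice[q qP] : forall ik : 'I_n * 'I_d, exists q : rat,
    `|tnth (tnth t ik.1) ik.2 - ratr q| < m.+1%:R^-1.
  move=> [i k] /=; set a := tnth _ k; move: (m.+1%:R^-1) m0 => r r0.
  have [|q] := @rat_in_itvoo _ (a - r) (a + r); first lra.
  rewrite in_itv /= => /andP[h1 h2]; exists q; rewrite ltr_norml.
  by apply/andP; split; lra.
pose w : index := ([tuple [tuple q (i, k) | k < d] | i < n], m).
exists w; rewrite /separating_box asboolT.
  by move=> i k; rewrite /= !tnth_mktuple; exact: (qP (i, k)).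
move=> i j ij; apply/seteqP; split => // x [xi xj].
have [k] := mP i j ij; apply/negP; rewrite -ltNge.
have := xi k; have := xj k; have := qP (i, k); have := qP (j, k).
rewrite /= !tnth_mktuple !ltr_norml => /andP[a1 a2] /andP[b1 b2] /andP[c1 c2] /andP[e1 e2].
move: (m.+1%:R^-1) a1 a2 b1 b2 c1 c2 e1 e2 => r a1 a2 b1 b2 c1 c2 e1 e2.
by apply/andP; split; lra.
Qed.

End SeparatingBoxes.

Lemma poisson_prob_set1 (R : realType) (r : R) (k : nat) : 0 <= r ->
  poisson_prob r 0%N [set k] = (r ^+ k * k`!%:R^-1 * expR (- r))%:E.
Proof.
move=> r0; rewrite /poisson_prob; case: ifPn => [rp|].
  rewrite esum_set1 ?lee_fin ?poisson_pmf_ge0 //.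
  by rewrite /poisson_pmf rp.
rewrite -leNgt => r0'; have -> : r = 0 by apply/eqP; rewrite eq_le r0' r0.
rewrite oppr0 expR0 mulr1 diracE; case: k => [|k].
  by rewrite mem_set // expr0 fact0 invr1 mulr1.
by rewrite memNset // expr0n /= mul0r.
Qed.

Section Occupancy.
Context {U : Type}.

Definition occupancy (m : nat) (p : nat -> U) (A : set U) : nat := #|[set i : 'I_m | p i \in A]|.

Lemma occupancyE m p A : occupancy m p A = #|[set i : 'I_m | p i \in A]%SET|.
Proof.
apply: eq_card => i; rewrite !inE; apply/idP/idP => [/set_mem //|h].
exact/mem_set.
Qed.

(** Translates counts into labels: one point in each [A i] and none elsewhere means that sending [i]
    to the point in [A i] is a bijection, which yields [m = n] as well as the permutation. *)
Lemma occupancy_matching (n m : nat) (p : nat -> U) (A : 'I_n -> set U) (C : set U) :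
  (forall i, (i < m)%N -> C (p i)) -> (forall i j, i != j -> A i `&` A j = set0) ->
  (m = n /\ exists s : 'S_n, forall i, A i (p (s i))) <->
  (forall i, occupancy m p (A i) = 1%N) /\ occupancy m p (C `\` \bigcup_i A i) = 0%N.
Proof.
move=> pC tA; split.
  move=> [mn [s sP]]; subst m; split.
    move=> i; rewrite occupancyE (_ : [set _ | _]%SET = [set s i]%SET) ?cards1 //.
    apply/setP => l; rewrite !inE; apply/idP/eqP => [/set_mem Ai|->]; last exact: mem_set.
    apply: contrapT => li; have ne : s^-1%g l != i.
      by apply/eqP => e; apply: li; rewrite -e permKV.
    have : (A (s^-1%g l) `&` A i) (p l) by split => //; have := sP (s^-1%g l); rewrite permKV.
    by rewrite tA.
  apply/eqP; rewrite occupancyE cards_eq0; apply/eqP/setP => l; rewrite !inE; apply/negbTE/negP => /set_mem [_].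
  by apply; exists (s^-1%g l) => //; have := sP (s^-1%g l); rewrite permKV.
move=> [A1 C0].
have /choice[f fP] : forall i, exists l : 'I_m, [set j : 'I_m | p j \in A i]%SET = [set l]%SET.
  by move=> i; apply/cards1P; rewrite -occupancyE A1.
have Af i : A i (p (f i)).
  have : f i \in [set j : 'I_m | p j \in A i]%SET by rewrite fP set11.
  by rewrite inE => /set_mem.
have f_inj : injective f.
  move=> i j e; apply: contrapT => /eqP ij; have : (A i `&` A j) (p (f i)) by split; [|rewrite e]; exact: Af.
  by rewrite tA.
have f_surj l : exists i, f i = l.
  apply: contrapT => nl; have : l \in [set j : 'I_m | p j \in C `\` \bigcup_i A i]%SET.
    rewrite inE; apply/mem_set; split; first exact: pC.
    move=> [i _ Ai]; apply: nl; exists i.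
    have : l \in [set j : 'I_m | p j \in A i]%SET by rewrite inE; exact: mem_set.
    by rewrite fP inE => /eqP.
  by move/eqP: C0; rewrite occupancyE cards_eq0 => /eqP ->; rewrite inE.
have /choice[g gP] := f_surj.
have mn : m = n.
  have := bij_eq_card (Bijective (f := f) (g := g) (fun i => f_inj _ _ (gP (f i))) gP).
  by rewrite !card_ord.
split => //; move: f f_inj Af {fP f_surj gP}; rewrite mn => f f_inj Af.
by exists (perm f_inj) => i; rewrite permE.
Qed.

End Occupancy.

Section PoissonLaw.
Context {R : realType} {d : nat} {disp : measure_display} {T : measurableType disp}.
Context {P : probability T R} {lambda : R} (hlambda : 0 < lambda).
Context {N : {RV P >-> nat}} {X : nat -> {RV P >-> d.-tuple R}}.
Hypothesis hX : poisson_process_on_cube P N X lambda.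
Local Open Scope ereal_scope.

Definition centers (n : nat) (w : T) : n.-tuple (d.-tuple R) := [tuple X i w | i < n].

Lemma measurable_centers n : measurable_fun setT (centers n).
Proof.
apply/measurable_fun_tnthP => i; rewrite (_ : _ \o _ = X i); first exact: measurable_funPT.
by apply/funext => w /=; rewrite tnth_mktuple.
Qed.

Lemma measurable_center_number n : measurable [set w | N w = n].
Proof. by rewrite -[X in measurable X]setTI; exact: (measurable_funPT N measurableT [set n]). Qed.

Lemma measurable_centers_event n (B : set (n.-tuple (d.-tuple R))) : measurable B ->
  measurable [set w | B (centers n w)].
Proof.
by move=> mB; rewrite -[X in measurable X]setTI; exact: (@measurable_centers n measurableT _ mB).
Qed.

Lemma volume_ge0 (A : set (d.-tuple R)) : 0 <= volume A.
Proof. by rewrite -volume_measureE. Qed.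

Lemma volume_fin (A : set (d.-tuple R)) : measurable A -> A `<=` @cube R d -> volume A \is a fin_num.
Proof.
move=> mA Ac; rewrite -volume_measureE ge0_fin_numE //.
have Ale : volume_measure d A <= volume_measure d (@cube R d).
  exact: (le_measure _ (mem_set mA) (mem_set (@measurable_cube R d)) Ac).
by rewrite (le_lt_trans Ale) // volume_measureE volume_cube ltry.
Qed.

Lemma prob_count (A : set (d.-tuple R)) (m : nat) : measurable A -> A `<=` @cube R d ->
  P [set w | center_count N X A w = m] =
  ((lambda * fine (volume A)) ^+ m * m`!%:R^-1 * expR (- (lambda * fine (volume A))))%:E.
Proof.
move=> mA Ac; have [_ _ hc _] := hX.
rewrite -poisson_prob_set1; last by rewrite mulr_ge0 ?fine_ge0 ?volume_ge0 // ltW.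
by rewrite -hc.
Qed.

Definition total_intensity : R := lambda * 2 ^+ d.

Lemma relabel_box_event n (A : 'I_n -> set (d.-tuple R)) (s : 'S_n) w :
  tuple_box A (relabel_cfg s (centers n w)) <-> forall i, A i (X (s i) w).
Proof. by split=> h i; have := h i; rewrite !tnth_mktuple. Qed.

Lemma measurable_relabel n (s : 'S_n) : measurable_fun setT (@relabel_cfg R d n s).
Proof. exact: measurable_perm_tuple. Qed.

Lemma measurable_relabel_event n (B : set (n.-tuple (d.-tuple R))) (s : 'S_n) : measurable B ->
  measurable [set w | B (relabel_cfg s (centers n w))].
Proof.
move=> mB; rewrite -[X in measurable X]setTI.
have mf : measurable_fun setT (relabel_cfg s \o centers n).
  by apply: measurableT_comp; [exact: measurable_relabel | exact: measurable_centers].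
exact: (mf measurableT _ mB).
Qed.

(** The events of distinct relabelings are disjoint, and their union says that each [A i] contains
    one center and the rest of the cube none. Independence of the counts gives a product of Poisson
    probabilities. *)
Lemma poisson_law_box n (A : 'I_n -> set (d.-tuple R)) : (forall i, measurable (A i)) ->
  disjoint_family A -> (forall i, A i `<=` @cube R d) ->
  \sum_(s : 'S_n) P ([set w | N w = n] `&` [set w | tuple_box A (relabel_cfg s (centers n w))]) =
  (expR (- total_intensity) * lambda ^+ n)%:E * \prod_(i < n) volume (A i).
Proof.
move=> mA tA Ac.
rewrite -measure_bigcup_finType; last 2 first.
- move=> s; apply: measurableI; first exact: measurable_center_number.
  by apply: measurable_relabel_event; exact: measurable_tuple_box.
- move=> s s' ss'; apply/seteqP; split => // w [[/= Nn /relabel_box_event sA] [_ /relabel_box_event sA']].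
  case/eqP: ss'; apply/permP => i.
  have [h _] := (@occupancy_matching _ n n (fun i => X i w) A setT (fun _ _ => I) tA).1
    (conj erefl (ex_intro _ s sA)).
  have /cards1P[l lP] : #|[set j : 'I_n | X j w \in A i]%SET| == 1%N by rewrite -(occupancyE n (fun i => X i w)) h.
  have : s i \in [set j : 'I_n | X j w \in A i]%SET by rewrite inE; exact/mem_set.
  have : s' i \in [set j : 'I_n | X j w \in A i]%SET by rewrite inE; exact/mem_set.
  by rewrite lP !inE => /eqP -> /eqP ->.
(* Index 0 is the rest of the cube, with count 0; the others are the [A i], with count 1. *)
pose B (j : 'I_n.+1) := oapp A (@cube R d `\` \bigcup_i A i) (unlift ord0 j).
pose m (j : 'I_n.+1) : nat := if unlift ord0 j is Some _ then 1%N else 0%N.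
have B0 : B ord0 = @cube R d `\` \bigcup_i A i by rewrite /B unlift_none.
have BS i : B (lift ord0 i) = A i by rewrite /B liftK.
have m0 : m ord0 = 0%N by rewrite /m unlift_none.
have mS i : m (lift ord0 i) = 1%N by rewrite /m liftK.
have mU : measurable (\bigcup_i A i) by apply: fin_bigcup_measurable.
have mB j : measurable (B j).
  by case: (unliftP ord0 j) => [i ->|->]; rewrite ?B0 ?BS //; apply: measurableD => //; exact: (@measurable_cube R d).
have Bc j : B j `<=` @cube R d.
  by case: (unliftP ord0 j) => [i ->|->]; rewrite ?B0 ?BS //; apply: subDsetl.
have tB i j : i != j -> B i `&` B j = set0.
  have t0 l : B ord0 `&` B (lift ord0 l) = set0.
    by rewrite B0 BS; apply/seteqP; split => // x [[_ nA] Al]; apply: nA; exists l.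
  case: (unliftP ord0 i) => [i' ->|->]; case: (unliftP ord0 j) => [j' ->|->] // ij.
  - by rewrite !BS; apply: tA; apply: contra_neq ij => ->.
  - by rewrite setIC.
have [_ Xc _ hind] := hX.
rewrite (_ : \bigcup_s _ = [set w | forall j, center_count N X (B j) w = m j]); last first.
  apply/seteqP; split => w /=.
    move=> [s _ [/= Nn /relabel_box_event sA]].
    have [h1 h0] := (@occupancy_matching _ n (N w) (fun i => X i w) A (@cube R d) (Xc w) tA).1
      (conj Nn (ex_intro _ s sA)).
    by move=> j; case: (unliftP ord0 j) => [i ->|->]; rewrite ?BS ?B0 ?mS ?m0; [exact: h1 | exact: h0].
  move=> cB.
  have [|Nn [s sA]] := (@occupancy_matching _ n (N w) (fun i => X i w) A (@cube R d) (Xc w) tA).2.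
    split => [i|]; first by have := cB (lift ord0 i); rewrite BS mS.
    by have := cB ord0; rewrite B0 m0.
  by exists s => //; split => //; apply/relabel_box_event.
transitivity (\prod_(j < n.+1) P [set w | center_count N X (B j) w = m j]).
  exact: (hind n.+1 B m mB Bc tB).
under eq_bigr do rewrite prob_count //.
(* The [B j] partition the cube, so the exponential factors combine into
   [expR (- total_intensity)]. *)
have volB : (\sum_(j < n.+1) fine (volume (B j)) = 2 ^+ d)%R.
  apply: EFin_inj; rewrite -volume_cube -sumEFin.
  under eq_bigr do rewrite fineK ?volume_fin // -volume_measureE.
  rewrite -measure_bigcup_finType // volume_measureE; congr volume.
  apply/seteqP; split => x; first by move=> [j _]; exact: Bc.
  move=> cx; have [[i _ Ai]|nA] := pselect ((\bigcup_i A i) x).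
    by exists (lift ord0 i); rewrite ?BS.
  by exists ord0; rewrite ?B0.
rewrite prodEFin (eq_bigr (fun j => (lambda * fine (volume (B j))) ^+ m j *
   expR (- (lambda * fine (volume (B j)))))%R); last first.
  by move=> j _; rewrite /m; case: unlift => [_|]; rewrite ?fact0 /= ?invr1 ?mulr1.
rewrite big_split /= -expR_sum sumrN -mulr_sumr volB -/total_intensity.
rewrite big_ord_recl m0 expr0 mul1r.
rewrite (eq_bigr (fun i => lambda * fine (volume (A i)))%R); last by move=> i _; rewrite BS mS expr1.
rewrite big_split /= prodr_const card_ord mulrC mulrA.
rewrite EFinM -prodEFin; congr (_ * _); apply: eq_bigr => i _.
by rewrite fineK ?volume_fin.
Qed.

End PoissonLaw.

Section PoissonLawGeneral.
Context {R : realType} {d : nat} {disp : measure_display} {T : measurableType disp}.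
Context {P : probability T R} {lambda : R} (hlambda : 0 < lambda).
Context {N : {RV P >-> nat}} {X : nat -> {RV P >-> d.-tuple R}}.
Hypothesis hX : poisson_process_on_cube P N X lambda.
Local Open Scope ereal_scope.
Local Notation centers := (@centers R d disp T P X).

Lemma measurable_relabel_centers n (s : 'S_n) : measurable_fun setT (fun w => relabel_cfg s (centers n w)).
Proof.
by apply: (measurableT_comp (f := @relabel_cfg R d n s)); [exact: measurable_relabel | exact: measurable_centers].
Qed.

Definition relabeled_law n (s : 'S_n) : {measure set (n.-tuple (d.-tuple R)) -> \bar R} :=
  image_measure (mrestr P (@measurable_center_number R disp T P N n)) (@measurable_relabel_centers n s).

Lemma relabeled_lawE n (s : 'S_n) B :
  relabeled_law s B = P ([set w | N w = n] `&` [set w | B (relabel_cfg s (centers n w))]).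
Proof. by rewrite /relabeled_law /= /image_measure /= /mrestr setIC. Qed.

(* The listing [X] of the random set of centers is arbitrary, so only the sum over all
   relabelings is determined by the counts. *)
Definition symmetrized_law n : {measure set (n.-tuple (d.-tuple R)) -> \bar R} :=
  msum (fun k => relabeled_law (nth 1%g (enum {: 'S_n}) k)) #|{: 'S_n}|.

Lemma symmetrized_lawE n B : symmetrized_law n B =
  \sum_(s : 'S_n) P ([set w | N w = n] `&` [set w | B (relabel_cfg s (centers n w))]).
Proof.
rewrite /symmetrized_law /= /msum cardE.
rewrite -(big_mkord xpredT (fun k => relabeled_law (nth 1%g (enum {: 'S_n}) k) B)).
rewrite -(big_nth 1%g xpredT (fun s : 'S_n => relabeled_law s B)) big_enum.
by apply: eq_bigr => s _; exact: relabeled_lawE.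
Qed.

Definition law_constant (n : nat) : R := (expR (- (lambda * 2 ^+ d)) * lambda ^+ n)%R.

Lemma law_constant_ge0 n : (0 <= law_constant n)%R.
Proof. by rewrite mulr_ge0 ?expR_ge0 // exprn_ge0 // ltW. Qed.

Lemma symmetrized_law_cube n (A : 'I_n -> set (d.-tuple R)) :
  symmetrized_law n (tuple_box A) = symmetrized_law n (tuple_box (fun i => A i `&` @cube R d)).
Proof.
rewrite !symmetrized_lawE; apply: eq_bigr => s _; congr (P _).
have [_ Xc _ _] := hX.
apply/seteqP; split => w [/= Nn] /relabel_box_event h; split => //; apply/relabel_box_event => i.
  by split => //; apply: Xc; rewrite Nn.
by have [] := h i.
Qed.

(** Products of disjoint sets do not exhaust the boxes, so uniqueness is applied locally: within a
    separating box [Q], the trace of any box is such a product. The countable cover by these [Q]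
    then gives the equality. *)
Lemma poisson_law n (B : set (n.-tuple (d.-tuple R))) : measurable B -> B `<=` @good_cfg R d n ->
  symmetrized_law n B = (law_constant n)%:E * @cfg_measure R d n B.
Proof.
move=> mB Bg.
pose m2 := mscale (NngNum (law_constant_ge0 n)) (@cfg_measure R d n).
have m2E A : m2 A = (law_constant n)%:E * cfg_measure n A by [].
rewrite -m2E.
apply: (@measure_eq_cover _ _ _ _ _ _ (@separating_box R d n)) => //; first exact: measurable_separating_box.
  move=> w; rewrite /separating_box; case: asboolP => [tw|_] C mC; last by rewrite setI0 !measure0.
  set Q := tuple_box _.
  have mQ : measurable Q by apply: measurable_tuple_box => i; exact: measurable_rat_box.
  have boxE (A : 'I_n -> set (d.-tuple R)) : (forall i, measurable (A i)) ->
      symmetrized_law n (tuple_box A `&` Q) = m2 (tuple_box A `&` Q).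
    move=> mA; have mAw i : measurable (A i `&` rat_box w i).
      by apply: measurableI => //; exact: measurable_rat_box.
    rewrite /Q tuple_boxI symmetrized_law_cube m2E cfg_measureE tuple_power_box //.
    rewrite symmetrized_lawE (poisson_law_box hlambda hX).
    - by congr (_ * _); apply: eq_bigr => i _; rewrite [RHS]cube_measureE.
    - by move=> i; apply: measurableI => //; exact: (@measurable_cube R d).
    - move=> i j ij; apply/seteqP; split => // x [[[_ xi] _] [[_ xj] _]].
      by have : (rat_box w i `&` rat_box w j) x by []; rewrite tw.
    - by move=> i x [].
  apply/esym.
  apply: (@tuple_measure_unique R _ _ n (fun _ => setT) (mrestr m2 mQ) (mrestr (symmetrized_law n) mQ)) => //.
  - by rewrite -subTset => x _; exists 0%N.
  - move=> _; rewrite /= /mrestr.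
    have -> : tuple_box (fun _ : 'I_n => [set: d.-tuple R]) `&` Q = Q.
      by apply/seteqP; split => t; [case | split].
    rewrite [ltLHS]m2E cfg_measureE tuple_power_box; last by move=> i; exact: measurable_rat_box.
    rewrite (eq_bigr (fun i => (fine (volume (rat_box w i `&` @cube R d)))%:E)).
      by rewrite prodEFin -EFinM ltry.
    move=> i _; rewrite [LHS]cube_measureE fineK //; apply: volume_fin; last by move=> x [].
    by apply: measurableI => //; [exact: measurable_rat_box | exact: (@measurable_cube R d)].
  - by move=> A mA; apply/esym; exact: (boxE A mA).
by move=> t /Bg /separating_box_cover [w wt]; exists w.
Qed.

Lemma relabel_cfg1 n (t : n.-tuple (d.-tuple R)) : relabel_cfg 1%g t = t.
Proof. by apply: eq_from_tnth => i; rewrite tnth_mktuple perm1. Qed.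

Lemma degenerate_prob0 n (i j : 'I_n) : i != j ->
  P ([set w | N w = n] `&` [set w | degenerate_cfg i j (centers n w)]) = 0.
Proof.
move=> ij; apply/eqP; rewrite eq_le measure_ge0 andbT.
have := poisson_law (measurable_degenerate_cfg ij) (fun t h => h.1).
rewrite cfg_measure_degenerate // mule0 symmetrized_lawE => h0.
rewrite -h0 (bigD1 1%g) //= (_ : [set w | degenerate_cfg i j (relabel_cfg 1%g _)] =
  [set w | degenerate_cfg i j (centers n w)]).
  by rewrite leeDl // sume_ge0.
by apply/seteqP; split => w /=; rewrite relabel_cfg1.
Qed.

End PoissonLawGeneral.

(** * Colorings and chains *)

Section Colorings.
Context {R : realType} {d n : nat}.

Definition coloring_weight (b : {ffun 'I_n -> bool}) : R := \prod_i bernoulli_pmf d%:R^-1 (b i).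

Definition color_class (col : {ffun 'I_n -> 'I_d}) (k : 'I_d) : {ffun 'I_n -> bool} :=
  [ffun i => col i == k].

Lemma bernoulli_color (k : 'I_d) (e : bool) :
  bernoulli_pmf d%:R^-1 e = \sum_(c | (c == k) == e) d%:R^-1 :> R.
Proof.
have d0 : d%:R != 0 :> R by rewrite pnatr_eq0 -lt0n (leq_ltn_trans (leq0n k) (ltn_ord k)).
case: e => /=.
  by under eq_bigl do rewrite eqb_id; rewrite big_pred1_eq.
have : \sum_(c < d) d%:R^-1 = 1 :> R by rewrite sumr_const card_ord -[_ *+ _]mulr_natl divff.
rewrite (bigD1 k) //= => e; rewrite /bernoulli_pmf -[X in X - _]e [X in X - _]addrC addrK.
by apply: eq_bigl => c; case: (c == k).
Qed.

Lemma coloring_weightE (k : 'I_d) b :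
  coloring_weight b = \sum_(col : {ffun 'I_n -> 'I_d} | color_class col k == b) (d%:R ^- n : R).
Proof.
rewrite /coloring_weight; under eq_bigr do rewrite (bernoulli_color k).
rewrite bigA_distr_big_dep; apply: eq_big => [col|col _].
  apply/familyP/eqP => [h|<- i].
    by apply/ffunP => i; rewrite ffunE; have /eqP : (col i == k) == b i := h i.
  by change ((col i == k) == color_class col k i); rewrite ffunE.
by rewrite prodr_const card_ord exprVn.
Qed.

(** An average over black patterns becomes an average over [d]-colorings; the colorings do not
    depend on [k], only the class selected in them does. *)
Lemma sum_coloring_weight (k : 'I_d) (f : {ffun 'I_n -> bool} -> R) :
  \sum_b f b * coloring_weight b =
  \sum_(col : {ffun 'I_n -> 'I_d}) f (color_class col k) * d%:R ^- n.
Proof.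
rewrite [RHS](partition_big (color_class ^~ k) xpredT) //=; apply: eq_bigr => b _.
rewrite (coloring_weightE k) mulr_sumr; apply: eq_bigr => col /eqP <-.
by [].
Qed.

End Colorings.

Section BlackChains.
Context {R : realType} {d : nat} {disp : measure_display} {T : measurableType disp}.
Context {P : probability T R} {lambda : R} (hlambda : 0 < lambda).
Context {N : {RV P >-> nat}} {X : nat -> {RV P >-> d.-tuple R}}.
Hypothesis hX : poisson_process_on_cube P N X lambda.
Context {black : nat -> {RV P >-> bool}}.
Hypothesis hblack : iid_coloring P N X d%:R^-1 black.
Local Notation centers := (@centers R d disp T P X).

Definition connection (k : 'I_d) : set T :=
  [set w | black_chain_connects (N w) (fun i => X i w) (fun i => black i w) k].

(** Makes the chain events of the centers admissible as [G] in [iid_coloring]. *)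
Lemma centers_sigma n (B : set (n.-tuple (d.-tuple R))) : measurable B ->
  centers_sigma_algebra N X [set w | B (centers n w)].
Proof.
pose f := centers n.
suff : measurable `<=` [set B : set (n.-tuple (d.-tuple R)) | centers_sigma_algebra N X (f @^-1` B)].
  by move=> h /h.
apply: smallest_sub.
  have sC := @smallest_sigma_algebra T setT [set B | (exists U : set nat, B = N @^-1` U) \/
               (exists (i : nat) (A : set (d.-tuple R)), measurable A /\ B = X i @^-1` A)].
  have := @sigma_algebra_image T _ setT f (centers_sigma_algebra N X) sC.
  rewrite /image_set_system /=.
  have -> : [set B : set (n.-tuple (d.-tuple R)) | centers_sigma_algebra N X ([set: T] `&` f @^-1` B)] =
     [set B | centers_sigma_algebra N X (f @^-1` B)].
    by apply/seteqP; split => C /=; rewrite setTI.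
  by [].
move=> C; rewrite -bigcup_seq /= => -[i _ [A mA <-]].
apply: sub_sigma_algebra; right; exists i, A; split => //.
by apply/seteqP; split => w /=; rewrite tnth_mktuple; [case | split].
Qed.

Lemma centers_good n w : N w = n -> good_cfg (centers n w).
Proof.
move=> Nn; have [Xi Xc _ _] := hX; split => [i|i j ij]; rewrite !cfgE !tnth_mktuple.
  by apply: Xc; rewrite Nn.
have ilt : (i < N w)%N by rewrite Nn.
have jlt : (j < N w)%N by rewrite Nn.
move=> e; case/eqP: ij; apply/val_inj; exact: (Xi w i j ilt jlt e).
Qed.

Lemma connection_chain n w (b : {ffun 'I_n -> bool}) k : N w = n ->
  (forall i, (i < n)%N -> black i w = color_fun b i) ->
  connection k w <-> chain_cfg (color_fun b) k (centers n w).
Proof.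
move=> Nn bb; have [Xi Xc _ _] := hX.
have cE j : (j < n)%N -> X j w = cfg (centers n w) j.
  by move=> jn; rewrite -[j]/(nat_of_ord (Ordinal jn)) cfgE tnth_mktuple.
rewrite /connection /= Nn black_chain_strict; last 2 first.
- by move=> i j ilt jlt; apply: Xi; rewrite Nn.
- by move=> i ilt; apply: Xc; rewrite Nn.
split=> [h|[_ h]]; last by apply: strict_chain_ext h => j jn; rewrite ?cE ?bb.
by split; [exact: centers_good | apply: strict_chain_ext h => j jn; rewrite ?cE ?bb].
Qed.

Definition connection_piece n (k : 'I_d) (b : {ffun 'I_n -> bool}) : set T :=
  [set w | N w = n] `&` [set w | chain_cfg (color_fun b) k (centers n w)] `&`
  [set w | forall i, (i < n)%N -> black i w = color_fun b i].

Lemma measurable_connection_piece n k b : measurable (@connection_piece n k b).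
Proof.
apply: measurableI; first apply: measurableI.
- exact: measurable_center_number.
- by apply: measurable_centers_event; exact: measurable_chain_cfg.
apply: measurable_forall => i; apply: measurable_cstimpl => _.
rewrite -[X in measurable X]setTI; exact: (measurable_funPT (black i) measurableT [set color_fun b i]).
Qed.

Lemma connection_pieces n k : [set w | N w = n] `&` connection k = \bigcup_b @connection_piece n k b.
Proof.
apply/seteqP; split => w.
  move=> [Nn cw]; exists [ffun i : 'I_n => black i w] => //.
  have bb i : (i < n)%N -> black i w = color_fun [ffun i : 'I_n => black i w] i.
    by move=> ilt; rewrite -[i in RHS]/(nat_of_ord (Ordinal ilt)) color_funE ffunE.
  by split => //; split => //; apply/connection_chain.
by move=> [b _ [[Nn cb] bb]]; split => //; apply/(connection_chain _ Nn bb).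
Qed.

Lemma measurable_connection k : measurable (connection k).
Proof.
have -> : connection k = \bigcup_n ([set w | N w = n] `&` connection k).
  apply/seteqP; split => [w cw|w [n _ []] //]; by exists (N w).
apply: bigcupT_measurable => n; rewrite connection_pieces.
by apply: fin_bigcup_measurable => // b _; exact: measurable_connection_piece.
Qed.

Definition chain_prob n (b : {ffun 'I_n -> bool}) (k : 'I_d) : R :=
  fine (P ([set w | N w = n] `&` [set w | chain_cfg (color_fun b) k (centers n w)])).

Definition connection_prob n (k : 'I_d) : R := \sum_b chain_prob b k * @coloring_weight R d n b.

Lemma prob_fin (A : set T) : measurable A -> P A \is a fin_num.
Proof. by move=> mA; exact: fin_num_measure. Qed.

Lemma connection_probE n k :
  P ([set w | N w = n] `&` connection k) = (connection_prob n k)%:E.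
Proof.
rewrite connection_pieces measure_bigcup_finType; last 2 first.
- by move=> b; exact: measurable_connection_piece.
- move=> b b' bb'; apply/seteqP; split => // w [[_ wb] [_ wb']]; case/eqP: bb'.
  by apply/ffunP => i; rewrite -!color_funE -wb // -wb'.
rewrite /connection_prob -sumEFin; apply: eq_bigr => b _.
have hb := (@hblack n _ (color_fun b) (centers_sigma (@measurable_chain_cfg R d n (color_fun b) k))).
transitivity (P ([set w | N w = n] `&` [set w | chain_cfg (color_fun b) k (centers n w)] `&`
  [set w | forall i, (i < n)%N -> black i w = color_fun b i])); first by [].
apply: (etrans hb).
rewrite EFinM; congr (_ * _)%E.
  rewrite fineK // prob_fin //; apply: measurableI; first exact: measurable_center_number.
  by apply: measurable_centers_event; exact: measurable_chain_cfg.
by rewrite -prodEFin; apply: eq_bigr => i _; rewrite color_funE.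
Qed.

Lemma chain_cfg_relabelE n (s : 'S_n) (b : {ffun 'I_n -> bool}) k t :
  chain_cfg (color_fun [ffun i => b (s i)]) k (relabel_cfg s t) <->
  @chain_cfg R d n (color_fun b) k t.
Proof.
split; first exact: chain_cfg_relabel.
move=> h; apply: (@chain_cfg_relabel _ _ _ s^-1%g); rewrite relabel_cfgK.
by rewrite (_ : finfun _ = b) //; apply/ffunP => i; rewrite !ffunE permKV.
Qed.

Lemma chain_cfg_tperm n (b : nat -> bool) k k' :
  perm_cfg (tperm k k') @^-1` (@chain_cfg R d n b k) = chain_cfg b k'.
Proof.
have K (t : n.-tuple (d.-tuple R)) : perm_cfg (tperm k k') (perm_cfg (tperm k k') t) = t.
  apply: eq_from_tnth => i; rewrite !tnth_map; apply: eq_from_tnth => l.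
  by rewrite !tnth_perm_coord tpermK.
apply/seteqP; split => t /= h.
  by rewrite -(K t); apply: chain_cfg_perm; rewrite tpermR.
by apply: chain_cfg_perm; rewrite tpermL.
Qed.

(** Relabeling the centers and the pattern together preserves chains, and the weight of a pattern is
    invariant under relabeling. Hence [n!] times the probability is a weighted sum of symmetrized
    laws ([sumE]), where exchanging the coordinates [k] and [k'] preserves the measure. *)
Lemma connection_prob_sym n k k' : connection_prob n k = connection_prob n k'.
Proof.
have sumE k0 : #|{: 'S_n}|%:R * connection_prob n k0 =
    \sum_b fine (@symmetrized_law R d disp T P N X n (chain_cfg (color_fun b) k0)) * @coloring_weight R d n b.
  pose Q (s : 'S_n) (b : {ffun 'I_n -> bool}) := P ([set w | N w = n] `&`
     [set w | chain_cfg (color_fun b) k0 (relabel_cfg s (centers n w))]).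
  have Qfin s b : Q s b \is a fin_num.
    apply: prob_fin; apply: measurableI; first exact: measurable_center_number.
    by apply: measurable_relabel_event; exact: measurable_chain_cfg.
  rewrite (eq_bigr (fun b => \sum_(s : 'S_n) fine (Q s b) * @coloring_weight R d n b)); last first.
    move=> b _; rewrite -mulr_suml; congr (_ * _).
    by rewrite symmetrized_lawE sum_fine // => s _; exact: Qfin.
  rewrite exchange_big /= mulr_natl -sumr_const.
  apply: eq_bigr => s _.
  rewrite [RHS](reindex (fun b : {ffun 'I_n -> bool} => [ffun i => b (s i)])) /=; last first.
    exists (fun b : {ffun 'I_n -> bool} => [ffun i => b (s^-1%g i)]) => b _; apply/ffunP => i;
      by rewrite !ffunE ?permKV ?permK.
  apply: eq_bigr => b _; congr (_ * _).
    rewrite /chain_prob /Q; congr (fine (P (_ `&` _))); apply/seteqP; split => w /=.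
      by move/chain_cfg_relabelE.
    by move/chain_cfg_relabelE.
  rewrite /coloring_weight [LHS](reindex_inj (@perm_inj _ s)).
  by apply: eq_bigr => i _; rewrite ffunE.
have S0 : #|{: 'S_n}|%:R != 0 :> R.
  by rewrite pnatr_eq0 -lt0n; apply/card_gt0P; exists 1%g.
apply: (mulfI S0); rewrite !sumE; apply: eq_bigr => b _; congr (fine _ * _).
rewrite !(poisson_law hlambda hX); last by move=> t [].
- congr (_ * _)%E; rewrite -(chain_cfg_tperm n (color_fun b) k k') cfg_measure_perm //.
  exact: measurable_chain_cfg.
- exact: measurable_chain_cfg.
- by move=> t [].
- exact: measurable_chain_cfg.
Qed.

Lemma measure_le_bigcup (I : eqType) (s : seq I) (F : I -> set T) (E : set T) :
  (forall i, measurable (F i)) -> measurable E ->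
  E `<=` [set w | exists2 i, i \in s & F i w] -> (P E <= \sum_(i <- s) P (F i))%E.
Proof.
move=> mF; elim: s E => [|i s IH] E mE Es.
  by rewrite big_nil (_ : E = set0) ?measure0 //; apply/seteqP; split => // w /Es[].
rewrite big_cons.
have mD : measurable (E `\` F i) by exact: measurableD.
have EU : E `<=` F i `|` (E `\` F i).
  by move=> w Ew; have [|] := pselect (F i w); [left | right].
apply: (le_trans (le_measure _ (mem_set mE) (mem_set (measurableU _ _ (mF i) mD)) EU)).
apply: (le_trans (measureU2 _ (mF i) mD)); rewrite leeD2l //.
apply: IH => // w [/Es [l +] Fl nFi]; rewrite in_cons => /orP[/eqP li|ls]; last by exists l.
by case: nFi; rewrite -li.
Qed.

(** Union bound for one fixed coloring: by Hex, the [d] chain events and the degenerate events,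
    which have probability 0, cover [N = n]. *)
Lemma sum_chain_prob n (col : {ffun 'I_n -> 'I_d}) : (0 < n)%N ->
  fine (P [set w | N w = n]) <= \sum_k chain_prob (color_class col k) k.
Proof.
move=> n0.
pose F (i : 'I_d + 'I_n * 'I_n) : set T := match i with
  | inl k => [set w | N w = n] `&` [set w | chain_cfg (color_fun (color_class col k)) k (centers n w)]
  | inr ij => if ij.1 != ij.2 then
      [set w | N w = n] `&` [set w | degenerate_cfg ij.1 ij.2 (centers n w)] else set0
  end.
have mF i : measurable (F i).
  case: i => [k|[i j]] /=.
    apply: measurableI; first exact: measurable_center_number.
    by apply: measurable_centers_event; exact: measurable_chain_cfg.
  case: ifP => ij; last exact: measurable0.
  apply: measurableI; first exact: measurable_center_number.
  by apply: measurable_centers_event; exact: measurable_degenerate_cfg.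
have := @measure_le_bigcup _ (index_enum {: 'I_d + 'I_n * 'I_n}) F [set w | N w = n] mF
  (measurable_center_number n).
have cover : [set w | N w = n] `<=` [set w | exists2 i, i \in index_enum {: 'I_d + 'I_n * 'I_n} & F i w].
  move=> w Nn.
  have [[i [j [ij dij]]]|nd] := pselect (exists i j : 'I_n, i != j /\ degenerate_cfg i j (centers n w)).
    by exists (inr (i, j)); rewrite ?mem_index_enum //= ij.
  have [|k kP] := @hex_cfg R d n (centers n w) col n0 (centers_good Nn).
    by move=> i j ij dij; apply: nd; exists i, j.
  exists (inl k); rewrite ?mem_index_enum //=; split => //.
  rewrite (_ : color_fun _ = fun j => oapp (fun l => col l == k) false (insub j)) //.
  by apply/funext => j; rewrite /color_fun; case: insub => //= l; rewrite ffunE.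
move=> /(_ cover); rewrite big_sumType /=.
rewrite [X in (_ + X)%E]big1 ?adde0; last first.
  by move=> [i j] _ /=; case: ifPn => ij; [exact: (degenerate_prob0 hlambda hX) | exact: measure0].
move=> h; rewrite -lee_fin fineK; last by apply: prob_fin; exact: measurable_center_number.
rewrite -sumEFin; apply: (le_trans h); apply: lee_sum => k _.
by rewrite fineK //; apply: prob_fin; exact: (mF (inl k)).
Qed.

(** Once all terms are averages over the same [d ^ n] colorings, the two sums can be exchanged and
    the bound for a fixed coloring applied. *)
Lemma sum_connection_prob n : (0 < d)%N -> (0 < n)%N ->
  fine (P [set w | N w = n]) <= \sum_k connection_prob n k.
Proof.
move=> d0 n0; rewrite /connection_prob.
under eq_bigr => k _ do rewrite (sum_coloring_weight k (fun b => chain_prob b k)).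
rewrite exchange_big /=; under eq_bigr do rewrite -mulr_suml.
rewrite -mulr_suml ler_pdivlMr ?exprn_gt0 ?ltr0n //.
have -> : fine (P [set w | N w = n]) * d%:R ^+ n =
    \sum_(col : {ffun 'I_n -> 'I_d}) fine (P [set w | N w = n]).
  by rewrite sumr_const card_ffun !card_ord -natrX mulr_natr.
by apply: ler_sum => col _; exact: sum_chain_prob.
Qed.

Lemma connection_prob_ge n k : (0 < n)%N ->
  d%:R^-1 * fine (P [set w | N w = n]) <= connection_prob n k.
Proof.
move=> n0; have d0 : (0 < d)%N by exact: leq_ltn_trans (leq0n k) (ltn_ord k).
have := sum_connection_prob d0 n0.
rewrite (eq_bigr (fun=> connection_prob n k)); last by move=> k' _; exact: connection_prob_sym.
by rewrite sumr_const card_ord -[_ *+ _]mulr_natl => h; rewrite ler_pdivrMl ?ltr0n.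
Qed.

Lemma connection_lower_bound k :
  ((d%:R^-1)%:E * P [set w | (0 < N w)%N] <= P (connection k `&` [set w | (0 < N w)%N]))%E.
Proof.
pose L n : set T := if (0 < n)%N then [set w | N w = n] else set0.
pose C n : set T := if (0 < n)%N then [set w | N w = n] `&` connection k else set0.
have mN n : measurable [set w | N w = n] := @measurable_center_number R disp T P N n.
have mL n : measurable (L n) by rewrite /L; case: ifP.
have mC n : measurable (C n).
  by rewrite /C; case: ifP => // _; apply: measurableI => //; exact: measurable_connection.
have tL : trivIset setT L.
  apply/trivIsetP => i j _ _ ij; rewrite /L; case: ifP => _; last by rewrite set0I.
  case: ifP => _; last by rewrite setI0.
  by apply/seteqP; split => // w [/= ei ej]; rewrite -ei -ej eqxx in ij.
have tC : trivIset setT C.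
  apply/trivIsetP => i j _ _ ij; rewrite /C; case: ifP => _; last by rewrite set0I.
  case: ifP => _; last by rewrite setI0.
  by apply/seteqP; split => // w [[/= ei _] [/= ej _]]; rewrite -ei -ej eqxx in ij.
have LE : [set w | (0 < N w)%N] = \bigcup_n L n.
  apply/seteqP; split => [w /= w0|w [n _]]; first by exists (N w) => //; rewrite /L w0.
  by rewrite /L; case: ifP => // n0 /= ->.
have CE : connection k `&` [set w | (0 < N w)%N] = \bigcup_n C n.
  apply/seteqP; split => [w [cw /= w0]|w [n _]]; first by exists (N w) => //; rewrite /C w0.
  by rewrite /C; case: ifP => // n0 [/= -> cw].
rewrite CE LE !measure_semi_bigcup //; [|exact: bigcupT_measurable|exact: bigcupT_measurable].
rewrite -nneseriesZl //.
apply: lee_nneseries => [n _ _|n _]; first by rewrite mule_ge0 // lee_fin invr_ge0.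
rewrite /L /C; case: ifP => n0; last by rewrite measure0 mule0.
rewrite [leRHS]connection_probE -[X in (_ * X)%E](fineK (prob_fin (mN n))) -EFinM lee_fin.
exact: connection_prob_ge.
Qed.

(** The value is less than 1, so the event defining the conditional probability has positive
    probability. *)
Lemma prob_no_center : P [set w | N w = 0%N] = (expR (- (lambda * 2 ^+ d)))%:E.
Proof.
have [_ Xc _ _] := hX.
rewrite (_ : [set w | N w = 0%N] = [set w | center_count N X (@cube R d) w = 0%N]).
  rewrite (prob_count hlambda hX) //; last exact: (@measurable_cube R d).
  by rewrite volume_cube /= fact0 invr1 expr0 !mul1r.
apply/seteqP; split => w /= h.
  by rewrite /center_count; apply: eq_card0 => i; have ilt := ltn_ord i; exfalso; rewrite [X in (_ < X)%N]h in ilt.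
apply/eqP; rewrite -leqn0 leqNgt; apply/negP => w0.
have /eqP := h; rewrite -leqn0 leqNgt => /negP; apply.
apply/card_gt0P; exists (Ordinal w0); do 2!apply/mem_set; exact: Xc.
Qed.

Lemma prob_some_center_gt0 : 0 < fine (P [set w | (0 < N w)%N]).
Proof.
have mN := @measurable_center_number R disp T P N 0%N.
rewrite (_ : [set w | (0 < N w)%N] = ~` [set w | N w = 0%N]); last first.
  by apply/seteqP; split => w /=; rewrite lt0n => /eqP.
rewrite probability_setC // prob_no_center -EFinB /= subr_gt0 expR_lt1 oppr_lt0.
by rewrite mulr_gt0 // exprn_gt0.
Qed.

End BlackChains.

Theorem mainTheorem7 (R : realType) (d : nat) (hd : (0 < d)%N)
  (disp : measure_display) (T : measurableType disp) (P : probability T R)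
  (lambda : R) (hlambda : 0 < lambda)
  (N : {RV P >-> nat}) (X : nat -> {RV P >-> d.-tuple R})
  (hX : poisson_process_on_cube P N X lambda)
  (black : nat -> {RV P >-> bool})
  (hblack : iid_coloring P N X d%:R^-1 black)
  (k : 'I_d) :
  let connection :=
    [set w | black_chain_connects (N w) (fun i => X i w) (fun i => black i w) k]
  in
  measurable connection /\
  d%:R^-1 <= cond_prob P connection [set w | (0 < N w)%N].
Proof.
move=> connection; split; first exact: (measurable_connection hX).
rewrite /cond_prob ler_pdivlMr; last exact: (prob_some_center_gt0 hlambda hX).
have mN : measurable [set w | (0 < N w)%N].
  rewrite -[X in measurable X]setTI.
  exact: (measurable_funPT N measurableT [set n | (0 < n)%N]).
rewrite -lee_fin EFinM !fineK; [exact: (connection_lower_bound hlambda hX hblack) | | exact: prob_fin].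
by apply: prob_fin; apply: measurableI => //; exact: (measurable_connection hX).
Qed.
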